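(* Let $I\subset(0,\infty)$ be an interval and let $\Phi_\rho:E\to\mathbb{R}$, $\rho\in I$, be a family of $C^2$ functionals of the form $$\Phi_\rho(u)=A(u)-\rho B(u),$$ where $B(u)\ge0$ for all $u\in E$ and $$\text{either } A(u)\to+\infty \text{ or } B(u)\to+\infty \quad\text{as } u\in E \text{ and } \|u\|\to+\infty.$$ Suppose that $\Phi_\rho|_{S_\mu}$ is even for every $\rho\in I$, and moreover that, for some $\alpha\in(0,1]$, $\Phi_\rho'$ and $\Phi_\rho''$ are $\alpha$-Hölder continuous on bounded sets for every $\rho\in I$. Finally, suppose that there exist $N\in\mathbb{N}$, $N\ge2$, and odd functions $\gamma_i:S^{N-2}\to S_\mu$, $i=0,1$, such that the set $$\Gamma_N=\{\gamma\in C([0,1]\times S^{N-2},S_\mu): \gamma(t,\cdot)\text{ is odd for all } t,\ \gamma(0,\cdot)=\gamma_0,\ \gamma(1,\cdot)=\gamma_1\}$$ is non-empty and that $$c_{\rho,N}=\inf_{\gamma\in\Gamma_N}\ \max_{(t,x)\in[0,1]\times S^{N-2}}\Phi_\rho(\gamma(t,x))>\max_{x\in S^{N-2}}\big\{\Phi_\rho(\gamma_0(x)),\Phi_\rho(\gamma_1(x))\big\},\qquad\forall\rho\in I.$$ Then, for almost every $\rho\in I$, there exist sequences $\{u_n\}\subset S_\mu$ and $\zeta_n\to0^+$ such that, as $n\to+\infty$: (i) $\Phi_\rho(u_n)\to c_{\rho,N}$; (ii) $\|\Phi_\rho'|_{S_\mu}(u_n)\|_*\to0$; (iii) $\{u_n\}$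 is bounded in $E$; (iv) $\tilde m_{\zeta_n}(u_n)\le N$, where $\tilde m_{\zeta_n}$ is the approximate Morse index associated with $\Phi_\rho$.
   Context: Setting. $(E,\langle\cdot,\cdot\rangle)$ and $(H,(\cdot,\cdot))$ are infinite-dimensional real Hilbert spaces with continuous injections $E\hookrightarrow H\hookrightarrow E'$; the injection $E\hookrightarrow H$ has norm at most $1$ and $E$ is identified with its image in $H$. Write $\|u\|^2=\langle u,u\rangle$ and $|u|^2=(u,u)$ for $u\in E$. For a fixed $\mu\in(0,+\infty)$, $S_\mu=\{u\in E: |u|^2=\mu\}$, a codimension-one submanifold of $E$ with tangent space $T_uS_\mu=\{v\in E:(u,v)=0\}$ at $u\in S_\mu$; $S_\mu$ carries the topology induced from $E$. $S^{N-2}$ denotes the unit sphere of $\mathbb{R}^{N-1}$ (so $S^0=\{-1,1\}$). $\|\cdot\|_*$ and $\|\cdot\|_{**}$ denote the operator norms of $\mathcal{L}(E,\mathbb{R})$ and $\mathcal{L}(E,\mathcal{L}(E,\mathbb{R}))$. For $u\in S_\mu$, $\phi'|_{S_\mu}(u)$ denotes the differential at $u$ of the restriction of $\phi$ to $S_\mu$, a linear form on $T_uS_\mu$, and $\|\phi'|_{S_\mu}(u)\|_*$ is its dual norm with respect to the norm $\|\cdot\|$ on $T_uS_\mu$ inherited from $E$. For a $C^2$ functional $\phi$ on $E$ and $\alpha\in(0,1]$, $\phi'$ and $\phi''$ are $\alpha$-Hölder continuous on bounded sets if for any $R>0$ there is $M=M(R)>0$ such that for all $u_1,u_2\in B(0,R)$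 (ball of $E$): $\|\phi'(u_1)-\phi'(u_2)\|_*\le M\|u_1-u_2\|^\alpha$ and $\|\phi''(u_1)-\phi''(u_2)\|_{**}\le M\|u_1-u_2\|^\alpha$. For a $C^2$ functional $\phi$ on $E$ and $u\in E\setminus\{0\}$, $D^2\phi(u)$ is the continuous bilinear form $D^2\phi(u)=\phi''(u)-\frac{\phi'(u)\cdot u}{|u|^2}(\cdot,\cdot)$. For $u\in S_\mu$ and $\theta>0$ the approximate Morse index (associated with $\phi$) is $$\tilde m_\theta(u)=\sup\{\dim L : L \text{ is a subspace of } T_uS_\mu \text{ such that } D^2\phi(u)[\varphi,\varphi]<-\theta\|\varphi\|^2 \ \forall\varphi\in L\setminus\{0\}\}.$$ *)

(* Defs.v *)
From HB Require Import structures.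
From mathcomp Require Export all_boot all_order all_algebra sesquilinear.
From mathcomp Require Export all_classical all_reals all_analysis.

Set Implicit Arguments.
Unset Strict Implicit.
Unset Printing Implicit Defensive.

Export Order.TTheory GRing.Theory Num.Theory.
Export numFieldNormedType.Exports.

Local Open Scope classical_set_scope.
Local Open Scope ring_scope.

(* Norm of (the restriction to the subspace T of) a linear map.  The supremum is
   that of a nonempty bounded set when f is linear and bounded on T. *)
Definition opnorm_on (R : realType) (V W : normedModType R) (T : set V)
    (f : V -> W) : R :=
  sup [set `|f v| | v in [set v | T v /\ `|v| <= 1]].

Section ContinuousLinear.
Context {R : realType} {V W : normedModType R}.
Implicit Types f g : V -> W.

Definition clin_pred : {pred V -> W} := fun f => `[< linear f /\ continuous f >].

Lemma clin_predP f : reflect (linear f /\ continuous f) (f \in clin_pred).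
Proof. exact: asboolP. Qed.

Lemma clin_pred_submod : submod_closed clin_pred.
Proof.
split; first by apply/clin_predP; split=> [a x y|x];
  [rewrite /GRing.zero /= scaler0 addr0|exact: cst_continuous].
move=> a f g /clin_predP[lf cf] /clin_predP[lg cg]; apply/clin_predP; split.
  move=> b x y; rewrite !fctE lf lg !scalerDr !scalerA (mulrC a b).
  by rewrite -!addrA; congr (_ + _); rewrite addrCA.
by move=> x; apply: cvgD; [apply: cvgZl_tmp; exact: cf|exact: cg].
Qed.

HB.instance Definition _ :=
  GRing.isSubmodClosed.Build R (V -> W) clin_pred clin_pred_submod.

End ContinuousLinear.
Arguments clin_pred {R} V W.

(* The space L(V, W) of continuous linear maps, with the operator norm. *)
Record clin (R : realType) (V W : normedModType R) := Clin {
  clin_fun :> V -> W ;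
  clin_subproof : clin_fun \in clin_pred V W }.

Section ClinNormed.
Context {R : realType} {V W : normedModType R}.

HB.instance Definition _ := [isSub for @clin_fun R V W].
HB.instance Definition _ := [Choice of clin V W by <:].
HB.instance Definition _ := [SubChoice_isSubLmodule of clin V W by <:].

Implicit Types f g : clin V W.

Lemma clin_linear f : linear f.
Proof. by have /clin_predP[] := clin_subproof f. Qed.

Lemma clin_continuous f : continuous f.
Proof. by have /clin_predP[] := clin_subproof f. Qed.

HB.instance Definition _ f := GRing.isLinear.Build R V W *:%R f (clin_linear f).

Definition clin_norm f : R := opnorm_on setT f.

Lemma clinD f g v : (f + g) v = f v + g v. Proof. by []. Qed.
Lemma clinZ a f v : (a *: f) v = a *: f v. Proof. by []. Qed.

Lemma clin_bounded f : exists M, forall v, `|f v| <= M * `|v|.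
Proof.
have /linear_boundedP/pinfty_ex_gt0[M _ fM] :=
  @continuous_linear_bounded _ _ _ 0 f (@clin_continuous f 0).
by exists M.
Qed.

Lemma clin_has_sup f :
  has_sup [set `|f v| | v in [set v | setT v /\ `|v| <= 1]].
Proof.
split; first by exists `|f 0|, 0 => //=; rewrite normr0.
have [M fM] := clin_bounded f; exists `|M| => _ [v [_ v1] <-].
apply: (le_trans (fM v)); apply: (le_trans (ler_norm _)).
by rewrite normrM normr_id ler_piMr.
Qed.

Lemma clin_norm_ge0 f : 0 <= clin_norm f.
Proof.
apply: (@le_trans _ _ `|f 0|) => //; apply: ub_le_sup; first exact: (clin_has_sup f).2.
by exists 0 => //=; rewrite normr0.
Qed.

Lemma clin_normP f v : `|f v| <= clin_norm f * `|v|.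
Proof.
have [->|v0] := eqVneq v 0; first by rewrite linear0 !normr0 mulr0.
have nv : 0 < `|v| by rewrite normr_gt0.
rewrite -ler_pdivrMr //; apply: ub_le_sup; first exact: (clin_has_sup f).2.
exists (`|v|^-1 *: v) => /=.
  by split => //; rewrite normrZ normfV normr_id mulVf ?gt_eqF.
by rewrite linearZ /= normrZ normfV normr_id mulrC.
Qed.

Lemma clin_norm_le f (M : R) :
  (forall v, `|v| <= 1 -> `|f v| <= M) -> clin_norm f <= M.
Proof.
move=> fM; apply: sup_le_ub => [|_ [v [_ v1] <-]]; last exact: fM.
exact: (clin_has_sup f).1.
Qed.

Lemma clin_normD f g : clin_norm (f + g) <= clin_norm f + clin_norm g.
Proof.
apply: clin_norm_le => v v1; rewrite clinD (le_trans (ler_normD _ _))// lerD//.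
- by rewrite (le_trans (clin_normP _ _))// ler_piMr// clin_norm_ge0.
- by rewrite (le_trans (clin_normP _ _))// ler_piMr// clin_norm_ge0.
Qed.

Lemma clin_normZ_le a f : clin_norm (a *: f) <= `|a| * clin_norm f.
Proof.
apply: clin_norm_le => v v1; rewrite clinZ normrZ ler_wpM2l//.
by rewrite (le_trans (clin_normP _ _))// ler_piMr// clin_norm_ge0.
Qed.

Lemma clin_normZ a f : clin_norm (a *: f) = `|a| * clin_norm f.
Proof.
apply/eqP; rewrite eq_le clin_normZ_le /=.
have [->|a0] := eqVneq a 0; first by rewrite normr0 mul0r clin_norm_ge0.
rewrite -ler_pdivlMl ?normr_gt0// -normfV.
by rewrite (le_trans _ (clin_normZ_le _ _))// scalerA mulVf// scale1r.
Qed.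

Lemma clin_norm0_eq0 f : clin_norm f = 0 -> f = 0.
Proof.
move=> f0; apply: val_inj; apply/funext => v /=.
by apply/normr0_eq0/eqP; rewrite eq_le normr_ge0 andbT;
  have := clin_normP f v; rewrite f0 mul0r.
Qed.

HB.instance Definition _ := Lmodule_isNormed.Build R (clin V W)
  clin_normD clin_normZ clin_norm0_eq0.

End ClinNormed.

(* The Frechet differential as a map V -> L(V, W); where f is not differentiable
   it may take the junk value 0. *)
Definition frechet (R : realType) (V W : normedModType R) (f : V -> W) (u : V) :
    clin V W :=
  insubd (0 : clin V W) ('d f u : V -> W).

Lemma frechetE (R : realType) (V W : normedModType R) (f : V -> W) (u : V) :
  differentiable f u -> frechet f u = 'd f u :> (V -> W).
Proof.
move=> df; rewrite /frechet -[LHS]/(val _) insubdK//.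
by apply/clin_predP; split; [exact: linearP|exact: diff_continuous].
Qed.

Section Functionals.
Context {R : realType} {E : normedModType R}.
Implicit Types phi : E -> R^o.

Definition D1 phi : E -> clin E R^o := frechet phi.
Definition D2 phi : E -> clin E (clin E R^o) := frechet (D1 phi).

Definition C2 phi :=
  [/\ forall u, differentiable phi u,
      forall u, differentiable (D1 phi) u &
      continuous (D2 phi)].

Definition holder_on_bounded (V : normedModType R) (alpha : R) (f : E -> V) :=
  forall r : R, 0 < r -> exists2 M : R, 0 < M &
    forall u1 u2, ball (0 : E) r u1 -> ball (0 : E) r u2 ->
      `|f u1 - f u2| <= M * `|u1 - u2| `^ alpha.

Definition coercive (f : E -> R) :=
  forall M : R, exists r : R, forall u, r <= `|u| -> M <= f u.

Definition lin_indep n (v : 'I_n -> E) :=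
  forall c : 'I_n -> R, \sum_(i < n) c i *: v i = 0 -> forall i, c i = 0.

(* Dimension of a subspace, as an element of [0, +oo]. *)
Definition edim (L : {pred E}) : \bar R :=
  ereal_sup [set n%:R%:E | n in [set n : nat |
    exists2 v : 'I_n -> E, (forall i, v i \in L) & lin_indep v]].

End Functionals.

(* A Hilbert space is a completeNormedModType whose norm is induced by an inner
   product. *)
Definition induces_norm (R : realType) (V : normedModType R)
    (ip : {dot V for idfun}) :=
  forall v, ip v v = `|v| ^+ 2.

(* The unit sphere of R^n for the Euclidean norm (the library norm on row
   vectors is the sup norm, with the same topology). *)
Definition sphere (R : realType) n : set 'rV[R]_n :=
  [set x | \sum_i x 0 i ^+ 2 = 1].
Arguments sphere {R} n.

Definition cylinder (R : realType) n : set (R * 'rV[R]_n) :=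
  `[0, 1] `*` sphere n.
Arguments cylinder {R} n.

Section Constrained.
Context {R : realType} {E H : normedModType R}.
Variables (ipH : {dot H for idfun}) (j : {linear E -> H}) (mu : R).

Definition Smu : set E := [set u | ipH (j u) (j u) = mu].

Definition tangent (u : E) : set E := [set v | ipH (j u) (j v) = 0].

(* On the submanifold Smu the differential of the restriction of phi is the
   restriction of phi'(u) to the tangent space. *)
Definition dnorm_restr (phi : E -> R^o) (u : E) : R :=
  opnorm_on (tangent u) (D1 phi u).

Definition Dsq (phi : E -> R^o) (u v w : E) : R :=
  D2 phi u v w - D1 phi u u / ipH (j u) (j u) * ipH (j v) (j w).

Definition approx_morse (phi : E -> R^o) (theta : R) (u : E) : \bar R :=
  ereal_sup [set edim L | L in [set L : {pred E} |
    [/\ submod_closed L, (forall v, v \in L -> tangent u v) &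
        forall v, v \in L -> v != 0 -> Dsq phi u v v < - theta * `|v| ^+ 2]]].

Definition odd_on n (g : 'rV[R]_n -> E) :=
  forall x, sphere n x -> g (- x) = - g x.

(* Maps on the cylinder are represented by functions on R * R^n, of which
   only the values on the cylinder matter. *)
Definition Gamma n (g0 g1 : 'rV[R]_n -> E) : set (R * 'rV[R]_n -> E) :=
  [set g | [/\ {within cylinder n, continuous g},
    (forall p, cylinder n p -> Smu (g p)),
    (forall t, t \in `[0, 1] -> odd_on (fun x => g (t, x))),
    (forall x, sphere n x -> g (0, x) = g0 x) &
    (forall x, sphere n x -> g (1, x) = g1 x)]].

(* The maximum is attained (continuity on a compact set); the infimum is that of
   a nonempty set bounded below by the values of phi on g0, when Gamma is
   nonempty.  Likewise for endmax below, g0 and g1 being then continuous. *)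
Definition minimax n (g0 g1 : 'rV[R]_n -> E) (phi : E -> R) : R :=
  inf [set sup [set phi (g p) | p in cylinder n] | g in Gamma g0 g1].

Definition endmax n (g0 g1 : 'rV[R]_n -> E) (phi : E -> R) : R :=
  sup [set y | exists2 x, sphere n x & y = phi (g0 x) \/ y = phi (g1 x)].

End Constrained.

(* Main.v *)
Require Import Defs.
Set Implicit Arguments.
Unset Strict Implicit.
Unset Printing Implicit Defensive.
From mathcomp Require Import lra measurable_realfun lebesgue_measure lebesgue_integral.

Local Open Scope classical_set_scope.
Local Open Scope ring_scope.

(** Why the theorem is true.

    _Monotonicity._  Let c(s) be the minimax level of Phi_s.  As B is
    nonnegative, c is non-increasing on I, so at almost every rho the quotients
    (c(s) - c(rho)) / (rho - s) stay bounded along some s increasing to rho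
    ([left_slopes_ae], an application of Fatou's lemma).  Fix such a rho.  Take
    e = rho - s and a curve g in Gamma that is e-optimal for Phi_s.  Then
    Phi_rho (g p) <= c(rho) + L e for all p; and where moreover
    Phi_rho (g p) >= c(rho) - e, the identity e * B = Phi_s - Phi_rho bounds
    B (g p), hence also A (g p), and coercivity bounds the norm of g p by a
    constant independent of e ([bounded_curves]).

    _Contradiction._  Let phi = Phi_rho and suppose that, for some del > 0, no
    point of S in that ball, at level within del of c(rho), has both a
    constrained differential of norm at most del and an approximate Morse index
    m_del at most N.  Then each such point is a descent point: either the
    differential gives a direction along which phi decreases at rate del, or
    D^2 phi is below - del on a space of tangent vectors of dimension k > N.
    The lemma [deformation] pushes the part of g above the level c(rho) - e
    down by some eta > 0 that does not depend on g, and moves nothing far below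
    that level, in particular not the two ends of the cylinder.  For e small
    compared with eta this yields a curve of Gamma on which phi stays below
    c(rho) ([almost_critical]).  Taking del = 1/(n+1) gives the sequence.

    _Deformation._  Points move on S by an explicit rational retraction [retr],
    along which phi has a second-order expansion with quadratic part D^2 phi,
    uniformly on bounded sets thanks to the Hoelder bounds
    ([slide_expansion]).  Near a point with a negative space V of dimension k,
    a step s in a unit direction w of V gains del/8 * s^2 up to s * tau,
    provided that the first derivative along w is at most tau ([descent]); so
    such a w has to be chosen in V continuously in the parameter p.  The first
    derivative, restricted to V, is a continuous map from the cylinder, a
    subset of R^N, to R^k.  As N < k, it can be perturbed by at most tau so as
    to have no zero ([avoid_zero]), and w is the normalised opposite of the
    perturbed vector ([direction_field]).

    The directions are only available locally, so the cylinder is covered by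
    small cubes and the curve is changed on one cube after the other, each time
    on the antipodal cube as well, in the odd way ([odd_step]).  A parameter
    lies in a number of enlarged cubes that is bounded in terms of N alone
    ([grid_cover]).  Hence the step length can be fixed before the mesh and yet
    the curve never leaves the neighbourhoods in which the estimates hold
    ([deform_seq]).  The errors tau are chosen last, after the number of
    cubes. *)

(** * Second-order Taylor bound *)

(** Replacing the values of continuous linear maps by fresh real variables
    keeps the arithmetic procedure from unfolding differentials. *)
Ltac clra :=
  repeat match goal with
  | H : is_true ?P |- _ => match P with context [@clin_fun _ _ _ _ _] => revert H end
  | H : ?P = ?Q |- _ =>
      match P with context [@clin_fun _ _ _ _ _] => revert H end
  end;
  repeat match goal with
  | H : context [@clin_fun _ _ _ _ _] |- _ => clear H end;
  repeat match goal with
  | |- context [@clin_fun ?R ?V ?W ?f ?v] => generalize (@clin_fun R V W f v : R); intro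
  end; intros; lra.

Section DifferentialsOnLines.
Context {R : realType}.
Implicit Types V W : normedModType R.

Lemma is_derive_line V W (f : V -> W) (u h : V) (t : R) :
  differentiable f (u + t *: h) ->
  is_derive t 1 (fun s : R => f (u + s *: h)) ('d f (u + t *: h) h).
Proof.
move=> df; have /derivableP := @diff_derivable _ _ _ _ _ h df.
rewrite deriveE// => -[dv dE].
have E : (fun s : R => s^-1 *: (((fun s : R => f (u + s *: h)) \o shift t) (s *: 1)
            - f (u + t *: h))) =
         (fun s : R => s^-1 *: ((f \o shift (u + t *: h)) (s *: h) - f (u + t *: h))).
  apply/funext => s /=; congr (_ *: (f _ - _)).
  by rewrite addrCA scalerDl /GRing.scale/= mulr1.
split; first by rewrite /derivable E.
by rewrite /derive E.
Qed.

Lemma clin_eval_continuous V W (h : V) : continuous (fun f : clin V W => f h).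
Proof.
move=> f; apply/(@cvgrPdist_le _ _ _ _ (nbhs_filter f)) => e e0.
have d0 : 0 < e / (1 + `|h|) by rewrite divr_gt0// ltr_pwDl.
have /nbhs_ballP fB : nbhs f (ball f (e / (1 + `|h|))).
  by apply/nbhs_ballP; exists (e / (1 + `|h|)).
apply/nbhs_ballP; case: fB => d /= dp B; exists d => // g /B.
rewrite -ball_normE/= => fg; have -> : f h - g h = (f - g) h by [].
rewrite (le_trans (clin_normP _ _))//.
apply: (@le_trans _ _ (e / (1 + `|h|) * (1 + `|h|))); last first.
  by rewrite divfK// gt_eqF// ltr_pwDl.
by apply: ler_pM; rewrite ?clin_norm_ge0//; [exact: ltW|rewrite lerDr].
Qed.

Lemma is_derive_clin_eval V W (f : R -> clin V W) (t : R) (df : clin V W) (h : V) :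
  is_derive t 1 f df -> is_derive t 1 (fun s => f s h) (df h).
Proof.
move=> [dv dE].
have C : (fun s : R => s^-1 *: ((f \o shift t) (s *: 1) - f t)) @ 0^' --> df.
  by rewrite -dE; exact: dv.
have := cvg_comp _ _ C (@clin_eval_continuous V W h df) => C'.
split; first by apply: cvgP C'.
exact: (cvg_lim _ C').
Qed.

Lemma D1E V (phi : V -> R^o) u : differentiable phi u -> D1 phi u = 'd phi u :> (V -> R).
Proof. by move=> d; rewrite /D1 frechetE. Qed.

(** Along the segment, t |-> phi'(u + t h) h - q t and then
    t |-> phi (u + t h) - phi'(u) h t - q t^2 / 2 have nonpositive derivatives,
    where q is the assumed bound on the second derivative. *)
Lemma taylor2_le V (phi : V -> R^o) (u h : V) (om : R) : C2 phi ->
  (forall t : R, 0 <= t <= 1 -> D2 phi (u + t *: h) h h <= D2 phi u h h + om) ->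
  phi (u + h) <= phi u + D1 phi u h + 2^-1 * (D2 phi u h h + om).
Proof.
move=> [d1 d2 _] H; set q := D2 phi u h h + om in H *; clearbody q.
have I1 (t : R) : is_derive t 1 (fun s : R => phi (u + s *: h)) (D1 phi (u + t *: h) h).
  by rewrite (D1E (d1 _)); exact: is_derive_line.
have I2 (t : R) : is_derive t 1 (fun s : R => (D1 phi (u + s *: h) h : R^o))
    (D2 phi (u + t *: h) h h).
  apply: is_derive_clin_eval.
  by rewrite /D2 frechetE//; exact: is_derive_line.
pose F1 (t : R) : R^o := D1 phi (u + t *: h) h - q * t.
have IF1 (t : R) : is_derive t 1 F1 (D2 phi (u + t *: h) h h - q).
  by apply: is_derive_eq; rewrite /GRing.scale/= mulr1.
have F1le (t : R) : 0 <= t <= 1 -> D1 phi (u + t *: h) h - q * t <= D1 phi u h.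
  move=> /andP[t0 t1].
  have := @ler0_derive1_le_cc R F1 0 1.
  have -> : D1 phi u h = F1 0 by rewrite /F1 scale0r addr0 mulr0 subr0.
  apply; rewrite ?in_itv/= ?lexx ?ler01 ?t0 ?t1//.
  - move=> x; rewrite in_itv/= => /andP[x0 x1].
    by rewrite derive1E (let: DeriveDef _ e := IF1 x in e) subr_le0 H// !ltW.
  - apply: continuous_subspaceT => x; apply: differentiable_continuous.
    by apply/derivable1_diffP; have [] := IF1 x.
pose F2 (t : R) : R^o := phi (u + t *: h) - D1 phi u h * t - 2^-1 * q * t ^+ 2.
have IF2 (t : R) : is_derive t 1 F2 (D1 phi (u + t *: h) h - D1 phi u h - q * t).
  apply: is_derive_eq; rewrite /GRing.scale/= !mulr1.
  clra.
have : F2 1 <= F2 0.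
  apply: (@ler0_derive1_le_cc R F2 0 1); rewrite ?in_itv/= ?lexx ?ler01//.
  - move=> x; rewrite in_itv/= => /andP[x0 x1].
    rewrite derive1E (let: DeriveDef _ e := IF2 x in e).
    have := F1le x; rewrite (ltW x0) (ltW x1) => /(_ isT); clra.
  - apply: continuous_subspaceT => x; apply: differentiable_continuous.
    by apply/derivable1_diffP; have [] := IF2 x.
rewrite /F2 scale1r scale0r addr0; clra.
Qed.

End DifferentialsOnLines.

(** * Uniform bounds on balls from Hoelder continuity *)

Section HolderBounds.
Context {R : realType} {E : normedModType R}.

Lemma holder_bounded (V : normedModType R) (alpha : R) (f : E -> V) (r : R) :
  0 < alpha -> holder_on_bounded alpha f ->
  exists C : R, forall u, `|u| <= r -> `|f u| <= C.
Proof.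
move=> a0 hf; pose s := Num.max r 0 + 1.
have s0 : 0 < s by rewrite ltr_pwDr// le_max lexx orbT.
have [M M0 HM] := hf s s0.
exists (`|f 0| + M * s `^ alpha) => u ur.
have us : `|u| < s by rewrite (le_lt_trans ur)//
  (@le_lt_trans _ _ (Num.max r 0)) ?le_max ?lexx// ltrDl.
have := HM u 0; rewrite -ball_normE/= !sub0r !normrN normr0 => /(_ us s0).
rewrite !subr0 => h; rewrite -[X in `|X| <= _](subrK (f 0)) (le_trans (ler_normD _ _))//.
rewrite addrC lerD2l (le_trans h)// ler_pM2l// ge0_ler_powR ?nnegrE//; exact: ltW.
Qed.

Lemma holder_unif_continuous (V : normedModType R) (alpha : R) (f : E -> V) (r : R) :
  0 < alpha -> holder_on_bounded alpha f -> forall eps, 0 < eps ->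
  exists2 eta, 0 < eta & forall u u', `|u| <= r -> `|u'| <= r -> `|u - u'| <= eta ->
    `|f u - f u'| <= eps.
Proof.
move=> a0 hf eps eps0; pose s := Num.max r 0 + 1.
have s0 : 0 < s by rewrite ltr_pwDr// le_max lexx orbT.
have rs : r < s by rewrite (@le_lt_trans _ _ (Num.max r 0)) ?le_max ?lexx// ltrDl.
have [M M0 HM] := hf s s0.
have eM : 0 < eps / M by rewrite divr_gt0.
exists ((eps / M) `^ alpha^-1); first by rewrite powR_gt0.
move=> u u' ur ur' uu'; have := HM u u'.
rewrite -ball_normE/= !sub0r !normrN => /(_ (le_lt_trans ur rs) (le_lt_trans ur' rs)).
move=> /le_trans; apply; rewrite -ler_pdivlMl// mulrC.
apply: (@le_trans _ _ (((eps / M) `^ alpha^-1) `^ alpha)).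
  by rewrite ge0_ler_powR ?nnegrE ?powR_ge0//; exact: ltW.
by rewrite -powRrM mulVf ?gt_eqF// powRr1// ltW.
Qed.

Section Bounds.
Variable phi : E -> R^o.

Definition D12_bounded (rad C : R) := forall u v w, `|u| <= rad ->
  `|D1 phi u v| <= C * `|v| /\ `|D2 phi u v w| <= C * `|v| * `|w|.

Definition D12_unif_continuous (rad : R) := forall eps, 0 < eps ->
  exists2 eta, 0 < eta & forall u u', `|u| <= rad -> `|u'| <= rad ->
    `|u - u'| <= eta -> forall v w,
    `|D1 phi u v - D1 phi u' v| <= eps * `|v| /\
    `|D2 phi u v w - D2 phi u' v w| <= eps * `|v| * `|w|.

End Bounds.

Lemma holder_D12 (phi : E -> R^o) (alpha mu r : R) : 0 < alpha ->
  holder_on_bounded alpha (D1 phi) -> holder_on_bounded alpha (D2 phi) ->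
  exists C, [/\ 1 <= C, r <= C, mu^-1 <= C, D12_bounded phi (r + 1) C &
     D12_unif_continuous phi (r + 1)].
Proof.
move=> a0 h1 h2.
have [C1 HC1] := holder_bounded (r + 1) a0 h1.
have [C2 HC2] := holder_bounded (r + 1) a0 h2.
exists (Num.max (Num.max 1 r) (Num.max mu^-1 (Num.max C1 C2))).
split; rewrite ?le_max ?lexx ?orbT//.
- move=> u v w ur; split.
    rewrite (le_trans (clin_normP _ _))// ler_wpM2r//.
    by rewrite (le_trans (HC1 _ ur))// !le_max lexx !orbT.
  rewrite (le_trans (clin_normP _ _))// ler_wpM2r//.
  apply: (le_trans (clin_normP (D2 phi u) v)); rewrite ler_wpM2r//.
  by rewrite (le_trans (HC2 _ ur))// !le_max lexx !orbT.
- move=> eps eps0.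
  have [e1 e10 H1] := holder_unif_continuous (r + 1) a0 h1 eps0.
  have [e2 e20 H2] := holder_unif_continuous (r + 1) a0 h2 eps0.
  exists (Num.min e1 e2); first by rewrite lt_min e10.
  move=> u u' ur ur'; rewrite le_min => /andP[uu1 uu2] v w; split.
    have := clin_normP (D1 phi u - D1 phi u') v => /le_trans; apply.
    by rewrite ler_wpM2r// H1.
  have -> : D2 phi u v w - D2 phi u' v w = (D2 phi u v - D2 phi u' v) w by [].
  apply: (le_trans (clin_normP _ _)); rewrite ler_wpM2r//.
  have -> : D2 phi u v - D2 phi u' v = (D2 phi u - D2 phi u') v by [].
  apply: (le_trans (clin_normP (D2 phi u - D2 phi u') v)); rewrite ler_wpM2r//.
  exact: H2.
Qed.
End HolderBounds.

(** * Lipschitz approximation on a compact set *)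

Section UniformContinuity.
Context {R : realType} {V W : normedModType R}.
Implicit Types (K : set V) (f : V -> W).

Lemma within_continuous_dist K f : {within K, continuous f} <->
  forall p, K p -> forall e : R, 0 < e -> exists2 d : R, 0 < d &
    forall q, K q -> `|p - q| < d -> `|f p - f q| < e.
Proof.
rewrite subspace_continuousP; split=> H p Kp.
  move=> e e0; have /cvgrPdist_lt/(_ _ e0) := H p Kp.
  rewrite near_withinE => /nbhs_ballP[d d0 B]; exists d => // q Kq pq.
  by apply: B => //; rewrite -ball_normE.
apply/cvgrPdist_lt => e e0; have [d d0 B] := H p Kp e e0.
rewrite near_withinE; apply/nbhs_ballP; exists d => // q /=.
by rewrite -ball_normE/= => pq Kq; exact: B.
Qed.

Lemma compact_unif_continuous K f : compact K -> {within K, continuous f} ->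
  forall e : R, 0 < e -> exists2 d : R, 0 < d &
    forall p q, K p -> K q -> `|p - q| < d -> `|f p - f q| < e.
Proof.
move=> /compact_near_coveringP Kc /within_continuous_dist fc e e0.
pose P (d : R) p := K p -> forall q, K q -> `|p - q| < d -> `|f p - f q| < e.
have : \forall d \near 0^'+, K `<=` P d.
  apply: Kc => x Kx; have e20 : 0 < e / 2 by rewrite divr_gt0.
  have [d d0 B] := fc x Kx _ e20.
  have d20 : 0 < d / 2 by rewrite divr_gt0.
  exists (ball x (d / 2), [set t : R | t < d / 2]).
    by split; [exact: nbhsx_ballx|apply: nbhs_right_lt].
  move=> [y t] /= [xy td] Ky q Kq yq; rewrite -ball_normE/= in xy.
  have xq : `|x - q| < d.
    rewrite -(subrKA y) (le_lt_trans (ler_normD _ _))//.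
    rewrite [ltRHS]splitr ltrD// (lt_trans yq)//.
  rewrite -(subrKA (f x)) (le_lt_trans (ler_normD _ _))//.
  rewrite [ltRHS]splitr ltrD//; last exact: B.
  by rewrite distrC B// (lt_trans xy)// ltr_pdivrMr// ltr_pMr// ltr1n.
move=> /nbhs_ballP[d /= d0 B]; exists (d / 2); first by rewrite divr_gt0.
move=> p q Kp Kq pq; apply: (B (d / 2)) => //; last by rewrite divr_gt0.
rewrite -ball_normE/= sub0r normrN gtr0_norm ?divr_gt0//.
by rewrite ltr_pdivrMr// ltr_pMr// ltr1n.
Qed.

End UniformContinuity.

Section LipschitzApproximation.
Context {R : realType} {V : normedModType R}.

(** The approximation is the inf-convolution of f with a steep cone: it is
    Lipschitz as an infimum of Lipschitz functions, and a slope that beats the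
    oscillation of f beyond the distance d of uniform continuity lets only the
    points closer than d compete in the infimum. *)
Lemma lipschitz_approx (K : set V) (f : V -> R) : compact K ->
  {within K, continuous f} -> forall tau : R, 0 < tau ->
  exists (g : V -> R) (L : R), [/\ 0 <= L,
    (forall p q, K p -> K q -> `|g p - g q| <= L * `|p - q|) &
    (forall p, K p -> `|f p - g p| <= tau)].
Proof.
move=> Kc fc tau tau0.
have [d d0 uc] := compact_unif_continuous Kc (fc : {within K, continuous (f : V -> R^o)}) tau0.
have [M M0 fM] : exists2 M : R, 0 <= M & forall p, K p -> `|f p| <= M.
  have /compact_bounded/pinfty_ex_gt0[M M0 MB] := continuous_compact fc Kc.
  by exists M; [exact: ltW|move=> p Kp; apply: MB; exists p].
(* with this slope the cone rises by the largest oscillation 2 M at distance d *)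
pose L := 2 * M / d.
have L0 : 0 <= L by rewrite divr_ge0 ?mulr_ge0// ltW.
have LdE : L * d = 2 * M by rewrite divfK// gt_eqF.
clearbody L.
pose g p := inf [set f q + L * `|p - q| | q in K].
have glb p : K p -> has_inf [set f q + L * `|p - q| | q in K].
  move=> Kp; split; first by exists (f p + L * `|p - p|), p.
  exists (- M) => _ [q Kq <-]; rewrite -[X in X <= _]addr0 lerD ?mulr_ge0//.
  by have := fM q Kq; rewrite ler_norml => /andP[].
have gle p q : K p -> K q -> g p <= f q + L * `|p - q|.
  by move=> Kp Kq; apply: ge_inf; [exact: (glb p Kp).2|exists q].
have glip p q : K p -> K q -> g p <= g q + L * `|p - q|.
  move=> Kp Kq; rewrite -lerBlDr; apply: lb_le_inf; first exact: (glb q Kq).1.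
  move=> _ [r Kr <-]; rewrite lerBlDr (le_trans (gle p r Kp Kr))//.
  rewrite -addrA lerD2l -mulrDr ler_wpM2l// [leRHS]addrC.
  by rewrite (le_trans _ (ler_normD _ _))// subrKA.
exists g, L; split => //.
  move=> p q Kp Kq; rewrite ler_norml lerBlDl glip// andbT.
  by rewrite lerNl opprB lerBlDl distrC glip.
move=> p Kp; have := gle p p Kp Kp; rewrite subrr normr0 mulr0 addr0 => gf.
rewrite ger0_norm ?subr_ge0// lerBlDl -lerBlDr.
apply: lb_le_inf; first exact: (glb p Kp).1.
move=> _ [q Kq <-]; have [pq|pq] := ltP `|p - q| d.
  have := uc p q Kp Kq pq; rewrite ltr_norml => /andP[_ h].
  have : 0 <= L * `|p - q| by rewrite mulr_ge0.
  lra.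
have : L * d <= L * `|p - q| by rewrite ler_wpM2l.
rewrite LdE.
have := fM p Kp; have := fM q Kq; rewrite !ler_norml => /andP[? ?] /andP[? ?].
lra.
Qed.

End LipschitzApproximation.

(** * General position: avoiding zero when the target has larger dimension *)

Lemma truncn_eq_dist (R : archiNumDomainType) (x y : R) : x \is Num.real -> y \is Num.real ->
  0 <= x -> 0 <= y -> Num.truncn x = Num.truncn y -> `|x - y| <= 1.
Proof.
move=> xr yr /truncn_itv/andP[x1 x2] /truncn_itv/andP[y1 y2] xy.
move: x1 x2; rewrite xy => x1 x2; rewrite real_ler_norml ?rpredB// lerBlDl lerBrDl.
move: x2 y2; rewrite -!natr1 => x2 y2.
rewrite (ltW (lt_le_trans x2 _)) ?lerD2r// andbT lerBlDr.
by rewrite (ltW (lt_le_trans y2 _)) ?lerD2r.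
Qed.

Lemma natr_dist_lt1 (R : realDomainType) (a b : nat) :
  `|a%:R - b%:R| < 1 :> R -> a = b.
Proof.
rewrite ltr_norml ltrBlDl => /andP[h1 h2]; apply/eqP.
rewrite eqn_leq -[(a <= b)%N]ltnS -[(b <= a)%N]ltnS -!(ltr_nat R) -!natr1 [X in X && _]h2/=.
lra.
Qed.

(** A pigeonhole form of the fact that a Lipschitz image of a set of dimension
    #|J| does not fill a cube of dimension k > #|J|.  Otherwise each of the
    Q ^ k points of a grid of step tau / Q is the image of some point.  Cut the
    source cube into about (c Q) ^ #|J| cells, with c so large that two points
    in the same cell have images closer than tau / Q: distinct grid points then
    come from distinct cells, which is absurd when Q is large. *)
Lemma lipschitz_image_gap (R : realType) (T : Type) (J : finType) (k : nat)
    (K : set T) (x : T -> J -> R) (F : T -> 'I_k -> R) (L tau : R) :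
  (#|J| < k)%N -> 0 < tau -> 0 <= L ->
  (forall p i, K p -> `|x p i| <= 1) ->
  (forall p q d, K p -> K q -> (forall i, `|x p i - x q i| <= d) ->
     forall l, `|F p l - F q l| <= L * d) ->
  exists y : 'I_k -> R, (forall l, 0 <= y l <= tau) /\
    forall p, K p -> exists l, F p l != y l.
Proof.
move=> Jk tau0 L0 x1 FL.
pose c := (Num.truncn (2 * L / tau)).+1.
have cE : 2 * L < tau * c%:R.
  have : 0 <= 2 * L / tau by rewrite divr_ge0 ?mulr_ge0// ltW.
  move=> /truncn_itv/andP[_]; rewrite ltr_pdivrMr// => h.
  by rewrite (mulrC tau).
(* q.+1 plays the role of Q; q = c.+1 ^ #|J| is what the final count needs *)
pose q := (c.+1 ^ #|J|)%N; pose m := (c * q.+1)%N.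
have m0 : (0 < m)%N by rewrite muln_gt0.
have mp : 0 < m%:R :> R by rewrite ltr0n.
have qp : 0 < q.+1%:R :> R by rewrite ltr0n.
apply: contrapT => H.
pose y (a : {ffun 'I_k -> 'I_q.+1}) l : R := tau * (a l)%:R / q.+1%:R.
have /choice[pt ptP] : forall a, exists p, K p /\ forall l, F p l = y a l.
  move=> a; apply: contrapT => Ha; apply: H; exists (y a); split.
    move=> l; rewrite divr_ge0 ?mulr_ge0// ?(ltW tau0)//=.
    by rewrite ler_pdivrMr// ler_pM2l// ler_nat ltnW.
  move=> p Kp; apply: contrapT => Hl; apply: Ha; exists p; split => // l.
  by apply/eqP/negPn/negP => Fl; apply: Hl; exists l.
pose u p i : R := m%:R * ((x p i + 1) / 2).
have u0 p i : K p -> 0 <= u p i <= m%:R.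
  move=> Kp; have := x1 p i Kp; rewrite ler_norml => /andP[a b].
  rewrite /u mulr_ge0 ?(ltW mp)//=; last by lra.
  by rewrite ler_piMr ?(ltW mp)//; lra.
pose cell p : {ffun J -> 'I_m.+1} := [ffun i => inord (Num.truncn (u p i))].
have cell_inj : injective (fun a => cell (pt a)).
  move=> a b ab; apply/ffunP => l; apply/val_inj/eqP => /=.
  have [Ka Fa] := ptP a; have [Kb Fb] := ptP b.
  have near_x i : `|x (pt a) i - x (pt b) i| <= 2 / m%:R.
    have /andP[ua0 uam] := u0 (pt a) i Ka; have /andP[ub0 ubm] := u0 (pt b) i Kb.
    have : `|u (pt a) i - u (pt b) i| <= 1.
      apply: truncn_eq_dist; rewrite ?num_real//.
      have /(congr1 val) := congr1 (fun f : {ffun J -> 'I_m.+1} => f i) ab.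
      rewrite !ffunE /= !inordK// ltnS -(@ler_nat R).
      - by have /andP[/le_trans-> ] := truncn_itv ub0.
      - by have /andP[/le_trans-> ] := truncn_itv ua0.
    have -> : u (pt a) i - u (pt b) i = (x (pt a) i - x (pt b) i) * (m%:R / 2).
      by rewrite /u; lra.
    rewrite normrM (gtr0_norm (_ : 0 < m%:R / 2)) ?divr_gt0//.
    by rewrite -ler_pdivlMr ?divr_gt0// mul1r invfM invrK mulrC.
  have := FL _ _ _ Ka Kb near_x l; rewrite Fa Fb => yy.
  have : `|(a l)%:R - (b l)%:R| < 1 :> R.
    have -> : (a l)%:R - (b l)%:R = (y a l - y b l) * (q.+1%:R / tau).
      by rewrite /y -mulrBl -mulrBr mulrA divfK ?gt_eqF// (mulrC tau) mulfK ?gt_eqF.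
    rewrite normrM (gtr0_norm (_ : 0 < q.+1%:R / tau)) ?divr_gt0//.
    rewrite -ltr_pdivlMr ?divr_gt0// (le_lt_trans yy)// invf_div mul1r.
    have c0 : 0 < c%:R :> R by rewrite ltr0n.
    by rewrite ltr_pdivlMr// /m natrM invfM !mulrA divfK ?gt_eqF// ltr_pdivrMr// (mulrC L).
  by move=> /natr_dist_lt1 ->.
(* m.+1 ^ #|J| <= (c.+1 * q.+1) ^ #|J| = q * q.+1 ^ #|J| < q.+1 ^ k *)
have := leq_card _ cell_inj; rewrite !card_ffun !card_ord; apply/negP; rewrite -ltnNge.
have qE : q = (c.+1 ^ #|J|)%N by [].
have mE : m = (c * q.+1)%N by [].
clearbody q m; apply: (@leq_ltn_trans (q * q.+1 ^ #|J|)).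
  rewrite {1}qE -expnMn mE.
  have [->|J0] := posnP #|J|; first by rewrite !expn0.
  by rewrite leq_exp2r// mulSn -addn1 addnC leq_add2r.
apply: (@leq_trans (q.+1 ^ #|J|.+1)); last by rewrite leq_pexp2l.
by rewrite expnS ltn_pmul2r// expn_gt0.
Qed.

Lemma rV_norm_coord (R : realType) n (x : 'rV[R]_n) i : `|x 0 i| <= `|x|.
Proof.
rewrite [leRHS]mx_normrE.
by rewrite (le_trans _ (le_bigmax _ (fun ij : 'I_1 * 'I_n => `|x ij.1 ij.2|) (0, i))).
Qed.

Lemma rV_norm_le (R : realType) n (x : 'rV[R]_n) d : 0 <= d ->
  (forall i, `|x 0 i| <= d) -> `|x| <= d.
Proof.
move=> d0 xd; rewrite [leLHS]mx_normrE; apply: bigmax_le => // -[i k] _.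
by rewrite ord1 xd.
Qed.

Section GeneralPosition.
Context {R : realType} {n : nat}.
Local Notation P := (R * 'rV[R]_n)%type.

(** The n.+1 coordinates of a point of R * R^n; the index None is the first
    factor. *)
Definition coord (p : P) (o : option 'I_n) : R := if o is Some i then p.2 0 i else p.1.

Lemma coord_norm_le (p : P) o : `|coord p o| <= `|p|.
Proof.
rewrite prod_normE le_max; case: o => [i|]/=; last by rewrite lexx.
by rewrite rV_norm_coord orbT.
Qed.

Lemma norm_le_coord (p : P) d : 0 <= d -> (forall o, `|coord p o| <= d) -> `|p| <= d.
Proof.
move=> d0 pd; rewrite prod_normE ge_max (pd None)/=.
by apply: rV_norm_le => // i; exact: (pd (Some i)).
Qed.

(** Replace l by a Lipschitz approximation and translate it by a small vector
    that is not in its image. *)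
Lemma avoid_zero (k : nat) (K : set P) (l : 'I_k -> P -> R) (tau : R) :
  compact K -> (forall p o, K p -> `|coord p o| <= 1) -> (n.+1 < k)%N ->
  (forall i, {within K, continuous (l i)}) -> 0 < tau ->
  exists l' : 'I_k -> P -> R, [/\ (forall i, {within K, continuous (l' i)}),
    (forall p i, K p -> `|l i p - l' i p| <= tau) &
    (forall p, K p -> exists i, l' i p != 0)].
Proof.
move=> Kc K1 nk lc tau0; have tau20 : 0 < tau / 2 by rewrite divr_gt0.
have /choice[g /choice[L gL]] := fun i => lipschitz_approx Kc (lc i) tau20.
pose M := \sum_i L i.
have LM i : L i <= M.
  by rewrite /M (bigD1 i)//= lerDl sumr_ge0// => m _; have [] := gL m.
have M0 : 0 <= M by rewrite sumr_ge0// => m _; have [] := gL m.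
have [|p q d Kp Kq pq i|y [y1 y2]] := lipschitz_image_gap (J := option 'I_n) (K := K) (x := coord)
   (F := fun p i => g i p) _ tau20 M0 K1.
- by rewrite card_option card_ord.
- have [_ /(_ p q Kp Kq) h _] := gL i; rewrite (le_trans h)//.
  have d0 : 0 <= d by rewrite (le_trans _ (pq None)).
  rewrite ler_pM//; first by have [] := gL i.
  apply: norm_le_coord => // o; rewrite (le_trans _ (pq o))//.
  by case: o => [m|] /=; rewrite ?mxE.
exists (fun i p => g i p - y i); split.
- move=> i; apply/(within_continuous_dist _ (_ : P -> R^o)) => p Kp e e0.
  have [Li0 h _] := gL i; exists (e / (L i + 1)); first by rewrite divr_gt0// ltr_wpDl.
  move=> q Kq; rewrite ltr_pdivlMr ?ltr_wpDl// => pq.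
  rewrite opprB addrA subrK (le_lt_trans (h p q Kp Kq))// (le_lt_trans _ pq)//.
  by rewrite mulrC ler_wpM2l// lerDl.
- move=> p i Kp; have [_ _ /(_ p Kp) h] := gL i.
  rewrite opprB addrA -addrAC (le_trans (ler_normD _ _))//.
  by rewrite [leRHS]splitr lerD//; have /andP[y0 yt] := y1 i; rewrite ger0_norm.
- by move=> p Kp; have [i gy] := y2 p Kp; exists i; rewrite subr_eq0.
Qed.

End GeneralPosition.

Section DirectionField.
Context {R : realType} {n : nat} {E : normedModType R}.
Local Notation P := (R * 'rV[R]_n)%type.

Lemma cvg_sum_ord (T : Type) (F : set_system T) {FF : Filter F} m (f : 'I_m -> T -> E)
    (a : 'I_m -> E) :
  (forall i, f i x @[x --> F] --> a i) ->
  \sum_i f i x @[x --> F] --> \sum_i a i.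
Proof.
by move=> fa; apply: (cvg_big (x0 := 0) (P := xpredT) (@add_continuous E)).
Qed.

(** The norm of the combination attains a positive minimum on the compact unit
    sphere of the coefficients. *)
Lemma lin_indep_bound k (v : 'I_k -> E) : (0 < k)%N -> lin_indep v -> exists2 c : R, 0 < c &
  forall a : 'I_k -> R, forall i, c * `|a i| <= `|\sum_i a i *: v i|.
Proof.
move=> k0 vI; pose S := [set a : 'rV[R]_k | `|a| = 1].
have sc (a : 'rV[R]_k) : (\sum_i b 0 i *: v i) @[b --> a] --> \sum_i a 0 i *: v i.
  apply: cvg_sum_ord => i; apply: cvgZr_tmp; exact: coord_continuous.
have fc : continuous (fun a : 'rV[R]_k => `|\sum_i a 0 i *: v i|).
  by move=> a; exact: (continuous_comp (sc a) (@norm_continuous _ _ _)).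
have Sc : compact S.
  apply: bounded_closed_compact.
    by exists 1; split => // x x1 a /= ->; exact: ltW.
  have -> : S = (fun a : 'rV[R]_k => `|a|) @^-1` [set 1] by [].
  by apply: closed_comp => [a _|]; [exact: norm_continuous|exact: closed_eq].
have S0 : S !=set0.
  exists (const_mx 1); rewrite /S/= /Num.norm/=; apply/eqP; rewrite eq_le.
  rewrite rV_norm_le//=; last by move=> i; rewrite mxE normr1.
  by have := rV_norm_coord (const_mx 1 : 'rV[R]_k) (Ordinal k0); rewrite mxE normr1.
have [c cS cmin] := EVT_min_rV S0 Sc (continuous_subspaceT fc).
rewrite inE in cS.
have c0 : 0 < `|\sum_i c 0 i *: v i|.
  rewrite normr_gt0; apply/eqP => /vI c0; move: cS; rewrite /S/=.
  have -> : c = 0 by apply/rowP => i; rewrite c0 mxE.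
  by rewrite normr0 => /eqP; rewrite eq_sym oner_eq0.
exists `|\sum_i c 0 i *: v i| => // a i.
pose r : 'rV[R]_k := \row_i a i.
have rE : \sum_i a i *: v i = \sum_i r 0 i *: v i by apply: eq_bigr => m _; rewrite mxE.
have ar : `|a i| <= `|r| by have := rV_norm_coord r i; rewrite mxE.
have [r0|r0] := eqVneq r 0.
  by move: ar; rewrite r0 normr0 normr_le0 => /eqP ->; rewrite normr0 mulr0.
have rp : 0 < `|r| by rewrite normr_gt0.
have /cmin : (`|r|^-1 *: r) \in S.
  by rewrite inE /S/= normrZ normfV normr_id mulVf// gt_eqF.
have -> : \sum_m (`|r|^-1 *: r) 0 m *: v m = `|r|^-1 *: (\sum_m r 0 m *: v m).
  by rewrite scaler_sumr; apply: eq_bigr => m _; rewrite mxE scalerA.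
rewrite normrZ normfV normr_id ler_pdivlMl// mulrC -rE => /(le_trans _); apply.
by rewrite ler_wpM2l.
Qed.

(** If l i p is the derivative in the direction v i, the vector w p is a unit
    vector of the span of v along which the derivative is at most tau.  It is
    the normalised opposite of sum_i l' i p v_i, for a perturbation l' of l
    without zeros; the vectors v i need not be orthogonal, because the
    coefficients of a unit vector are bounded by [lin_indep_bound]. *)
Lemma direction_field k (v : 'I_k -> E) (K : set P) (l : 'I_k -> P -> R) (tau : R) :
  compact K -> (forall p o, K p -> `|coord p o| <= 1) -> (n.+1 < k)%N ->
  lin_indep v -> (forall i, {within K, continuous (l i)}) -> 0 < tau ->
  exists w : P -> E, {within K, continuous w} /\ forall p, K p ->
    exists a : 'I_k -> R, [/\ w p = \sum_i a i *: v i, `|w p| = 1 &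
      \sum_i a i * l i p <= tau].
Proof.
move=> Kc K1 nk vI lc tau0; have k0 : (0 < k)%N by exact: leq_ltn_trans nk.
have kR : 0 < k%:R :> R by rewrite ltr0n.
have [c c0 cb] := lin_indep_bound k0 vI.
have t0 : 0 < tau * c / k%:R by rewrite divr_gt0 ?mulr_gt0.
have [l' [l'c l'l l'0]] := avoid_zero Kc K1 nk lc t0.
pose W p := - \sum_i l' i p *: v i.
have W0 p : K p -> 0 < `|W p|.
  move=> Kp; have [i li0] := l'0 p Kp; rewrite normrN.
  by rewrite (lt_le_trans _ (cb _ i))// mulr_gt0// normr_gt0.
have Wc : {within K, continuous W}.
  move=> x; apply: cvgN.
  apply: (@cvg_sum_ord _ _ (nbhs_filter (x : subspace K)) k
    (fun i p => l' i p *: v i) (fun i => l' i x *: v i)).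
  move=> i; apply: cvgZr_tmp.
  exact: l'c.
have wc : {within K, continuous (fun p => `|W p|^-1 *: W p)}.
  rewrite continuous_subspace_in => p; rewrite inE => Kp.
  apply: cvgZ; last exact: Wc.
  by apply: cvgV; [rewrite gt_eqF// W0|apply: cvg_norm; exact: Wc].
exists (fun p => `|W p|^-1 *: W p); split => // p Kp.
have Wp := W0 p Kp.
have w1 : `| `|W p|^-1 *: W p | = 1 by rewrite normrZ normfV normr_id mulVf// gt_eqF.
pose a i := - (`|W p|^-1 * l' i p); exists a.
have wE : `|W p|^-1 *: W p = \sum_i a i *: v i.
  rewrite /W scalerN scaler_sumr -sumrN; apply: eq_bigr => i _.
  by rewrite scalerA scaleNr.
split => //.
have ac i : `|a i| <= c^-1.
  by have := cb a i; rewrite -wE w1 -ler_pdivlMl// mulr1.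
have -> : \sum_i a i * l i p = \sum_i a i * l' i p + \sum_i a i * (l i p - l' i p).
  by rewrite -big_split/=; apply: eq_bigr => i _; rewrite -mulrDr addrC subrK.
apply: (@le_trans _ _ (0 + \sum_(i < k) (tau / k%:R))).
  apply: lerD.
    rewrite sumr_le0// => i _; rewrite mulNr oppr_le0 -mulrA mulr_ge0// -expr2 sqr_ge0//.
  apply: ler_sum => i _; rewrite (le_trans (ler_norm _))// normrM.
  have -> : tau / k%:R = c^-1 * (tau * c / k%:R).
    by rewrite mulrA mulrC (mulrC tau) !mulrA mulVf ?gt_eqF// mul1r mulrC.
  by rewrite ler_pM// l'l.
by rewrite add0r sumr_const card_ord -[leLHS]mulr_natr divfK// gt_eqF.
Qed.

End DirectionField.

(** * Coverings of the cylinder with bounded multiplicity *)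

Section GridCover.
Context {R : realType} {n : nat}.
Local Notation P := (R * 'rV[R]_n)%type.

Definition of_coord (f : option 'I_n -> R) : P := (f None, \row_i f (Some i)).

Lemma coord_of_coord f o : coord (of_coord f) o = f o.
Proof. by case: o => [i|] //=; rewrite mxE. Qed.

Lemma coordB (p q : P) o : coord (p - q) o = coord p o - coord q o.
Proof. by case: o => [i|] //=; rewrite !mxE. Qed.

(** Cubes of half-side eps centred at the points of a grid of step 2 eps cover.
    If a point is closer than 2 eps to two centres, their indices differ by at
    most 1 in each coordinate, so equal parities force equal indices: at most
    2 ^ n.+1 enlarged cubes meet. *)
Lemma grid_cover (eps : R) : 0 < eps -> exists (T : finType) (c : T -> P),
  (forall p, (forall o, `|coord p o| <= 1) -> exists a, `|p - c a| <= eps) /\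
  (forall p, (#|[pred a | (`|p - c a| < 2 * eps)%R]| <= 2 ^ n.+1)%N).
Proof.
move=> eps0; pose m := Num.truncn eps^-1.
pose c (a : {ffun option 'I_n -> 'I_m.+1}) : P :=
  of_coord (fun o => (2 * (a o)%:R + 1) * eps - 1).
exists {ffun option 'I_n -> 'I_m.+1}, c; split=> p.
  move=> p1; pose y o : R := (coord p o + 1) / (2 * eps).
  have e20 : 0 < 2 * eps by rewrite mulr_gt0.
  have p11 o : -1 <= coord p o <= 1 by rewrite -ler_norml.
  have y0 o : 0 <= y o.
    by rewrite divr_ge0// ?(ltW e20)//; have /andP[h _] := p11 o; lra.
  have yE o : coord p o = y o * (2 * eps) - 1.
    by rewrite divfK ?gt_eqF//; lra.
  have ym o : (Num.truncn (y o) <= m)%N.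
    apply: le_truncn; rewrite ler_pdivrMr// mulrCA mulVf ?gt_eqF// mulr1.
    by have /andP[_ h] := p11 o; lra.
  exists [ffun o => inord (Num.truncn (y o))]; apply: norm_le_coord; first exact: ltW.
  move=> o; rewrite coordB coord_of_coord ffunE inordK ?ltnS// yE.
  have /andP[h1 h2] := truncn_itv (y0 o).
  rewrite -natr1 in h2; set t := _%:R in h1 h2 *.
  have -> : y o * (2 * eps) - 1 - ((2 * t + 1) * eps - 1) = (2 * (y o - t) - 1) * eps.
    by clear; lra.
  rewrite normrM (gtr0_norm eps0) ler_piMl ?(ltW eps0)// ler_norml.
  by apply/andP; split; move: h1 h2; clear; lra.
pose f (a : {ffun option 'I_n -> 'I_m.+1}) : {ffun option 'I_n -> bool} := [ffun o => odd (a o)].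
rewrite -(card_in_imset (f := f)).
  apply: leq_trans (max_card _) _.
  by rewrite card_ffun card_bool card_option card_ord.
move=> a b; rewrite !inE => pa pb fab; apply/ffunP => o; apply/val_inj => /=.
have ab : `|c a - c b| < 4 * eps.
  rewrite -(subrKA p) (le_lt_trans (ler_normD _ _))//.
  by rewrite distrC; lra.
have /(le_lt_trans) /(_ ab) := coord_norm_le (c a - c b) o.
rewrite coordB !coord_of_coord.
have -> : (2 * (a o)%:R + 1) * eps - 1 - ((2 * (b o)%:R + 1) * eps - 1) =
   ((a o)%:R - (b o)%:R) * (2 * eps) by clear; lra.
rewrite normrM (gtr0_norm (_ : 0 < 2 * eps)) ?mulr_gt0//.
have -> : 4 * eps = 2 * (2 * eps) by clear; lra.
rewrite ltr_pM2r ?mulr_gt0// => abd.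
have := congr1 (fun g : {ffun option 'I_n -> bool} => g o) fab; rewrite !ffunE.
move: abd; move: (nat_of_ord (a o)) (nat_of_ord (b o)); clear.
have W (x y : nat) : (x <= y)%N -> `|x%:R - y%:R| < 2 :> R -> odd x = odd y -> x = y.
  move=> xy; rewrite distrC -natrB// ger0_norm// (ltr_nat R _ 2) => h od.
  apply/eqP; rewrite eqn_leq xy/= -subn_eq0.
  by move: h (oddB xy); rewrite od addbb; case: (y - x)%N => [|[|]].
move=> x y; case/orP: (leq_total x y); first exact: W.
by move=> yx; rewrite distrC => h1 h2; rewrite (W y x).
Qed.

End GridCover.

Section Bump.
Context {R : realType} {V : normedModType R}.

(** This is min (1, max (0, t)) for t = 2 - |p - c| / eps, written with absolute
    values so that its continuity is that of the norm. *)
Definition bump (c : V) (eps : R) (p : V) : R :=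
  let t := 2 - `|p - c| / eps in (1 + `|t| - `|t - 1|) / 2.

Lemma bump_continuous c eps : continuous (bump c eps : V -> R^o).
Proof.
move=> p.
have tc : (2 - `|q - c| / eps) @[q --> p] --> 2 - `|p - c| / eps.
  apply: cvgB; [exact: cvg_cst|apply: cvgM; [|exact: cvg_cst]].
  by apply: cvg_norm; apply: cvgB; [exact: cvg_id|exact: cvg_cst].
apply: cvgM; [|exact: cvg_cst]; apply: cvgB.
  by apply: cvgD; [exact: cvg_cst|exact: cvg_norm].
by apply: cvg_norm; apply: cvgB => //; exact: cvg_cst.
Qed.

Lemma bump01 c eps p : 0 <= bump c eps p <= 1.
Proof.
rewrite /bump; move: (2 - _) => t; apply/andP.
all: by case: (ger0P t) => t0; case: (ger0P (t - 1)) => t1; lra.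
Qed.

Lemma bump_neq0 c eps p : 0 < eps -> bump c eps p != 0 -> `|p - c| < 2 * eps.
Proof.
move=> eps0; apply: contraNT; rewrite -leNgt -ler_pdivlMr// => h; rewrite /bump.
move: (_ / eps) h => t h; rewrite (ler0_norm (_ : 2 - t <= 0)) ?subr_le0//.
rewrite (ler0_norm (_ : 2 - t - 1 <= 0)); last by lra.
by apply/eqP; lra.
Qed.

Lemma bump_eq1 c eps p : 0 < eps -> `|p - c| <= eps -> bump c eps p = 1.
Proof.
move=> eps0; rewrite -[X in _ <= X]mul1r -ler_pdivrMr// => h; rewrite /bump.
move: (_ / eps) h => t h.
by rewrite !ger0_norm; lra.
Qed.

End Bump.

Section Cylinder.
Context {R : realType} {n : nat}.
Local Notation P := (R * 'rV[R]_n)%type.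
Local Notation K := (@cylinder R n).

Definition antipode (p : P) : P := (p.1, - p.2).

Lemma antipodeK : involutive antipode.
Proof. by case=> t x; rewrite /antipode/= opprK. Qed.

Lemma sphereN x : @sphere R n x -> @sphere R n (- x).
Proof. by rewrite /sphere/= => <-; apply: eq_bigr => i _; rewrite mxE sqrrN. Qed.

Lemma antipode_cylinder p : K p -> K (antipode p).
Proof. by move=> [p1 p2]; split => //; exact: sphereN. Qed.

Lemma sphere_coord x i : @sphere R n x -> `|x 0 i| <= 1.
Proof.
move=> xS; rewrite -(@ler_pXn2r _ 2)// ?nnegrE// expr1n real_normK ?num_real//.
by rewrite -[leRHS]xS (bigD1 i)//= lerDl sumr_ge0// => m _; exact: sqr_ge0.
Qed.

Lemma cylinder_coord p o : K p -> `|coord p o| <= 1.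
Proof.
move=> [p1 p2]; case: o => [i|]; first exact: sphere_coord.
by move: p1; rewrite /= in_itv/= => /andP[p0 p1]; rewrite ger0_norm.
Qed.

Lemma cylinder_compact : compact K.
Proof.
apply: compact_setX; first exact: segment_compact.
apply: bounded_closed_compact.
  exists 1; split => // M M1 x xS; apply: rV_norm_le => [|i].
    by rewrite ltW// (lt_trans _ M1).
  by rewrite (le_trans (sphere_coord _ xS))// ltW.
have sc (x : 'rV[R]_n) : (\sum_i (y 0 i ^+ 2 : R^o)) @[y --> x] --> \sum_i (x 0 i ^+ 2 : R^o).
  apply: cvg_sum_ord => i; rewrite expr2; under eq_fun do rewrite expr2.
  by apply: cvgM; exact: coord_continuous.
have -> : @sphere R n = (fun x : 'rV[R]_n => \sum_i x 0 i ^+ 2) @^-1` [set 1] by [].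
by apply: closed_comp => [x _|]; [exact: sc|exact: closed_eq].
Qed.

Lemma antipode_dist (p q : P) : `|antipode p - antipode q| = `|p - q|.
Proof. by rewrite !prod_normE/= -opprD normrN. Qed.

Lemma within_continuous_antipode (V : normedModType R) (f : P -> V) :
  {within K, continuous f} -> {within K, continuous (f \o antipode)}.
Proof.
move=> /within_continuous_dist fc; apply/within_continuous_dist => p Kp e e0.
have [d d0 h] := fc _ (antipode_cylinder Kp) e e0.
exists d => // q Kq pq; apply: h; first exact: antipode_cylinder.
by rewrite antipode_dist.
Qed.

(** A point x of the unit sphere has a coordinate of size at least
    1 / sqrt n > 1 / n.+1, and x and - x differ by twice that much.  So a cube
    of the covering does not meet its antipode once the mesh is small. *)
Lemma antipode_far (p : P) (eps : R) : K p -> eps <= (2 * n.+1%:R)^-1 ->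
  4 * eps <= `|p - antipode p|.
Proof.
move=> [_ pS] epsn; rewrite leNgt; apply/negP => h.
have n0 : 0 < n.+1%:R :> R by rewrite ltr0n.
have x1 i : p.2 0 i ^+ 2 <= n.+1%:R^-1.
  have := le_lt_trans (coord_norm_le (p - antipode p) (Some i)) h.
  rewrite coordB /= mxE opprK.
  have -> : p.2 0 i + p.2 0 i = 2 * p.2 0 i by rewrite mulr_natl mulr2n.
  rewrite normrM (ger0_norm (_ : 0 <= 2))// => h1.
  have xn : `|p.2 0 i| <= n.+1%:R^-1.
    by rewrite invfM in epsn; move: (n.+1%:R^-1) epsn h1 => t; lra.
  rewrite -real_normK ?num_real// expr2 (le_trans _ xn)// ler_piMr//.
  by rewrite (le_trans xn)// invf_le1// ler1n.
have : \sum_(i < n) p.2 0 i ^+ 2 <= \sum_(i < n) n.+1%:R^-1 by exact: ler_sum.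
rewrite pS sumr_const card_ord -[leRHS]mulr_natl ler_pdivlMr// mul1r ler_nat.
by rewrite ltnn.
Qed.

End Cylinder.

(** * The retraction on the constraint *)

Lemma bounded_bilinear_cvg (R : realType) (U V W : normedModType R) (B : U -> V -> W)
    (T : Type) (F : set_system T) {FF : Filter F} (f : T -> U) (g : T -> V) (a : U) (b : V) :
  (forall x x' y, B (x - x') y = B x y - B x' y) ->
  (forall x y y', B x (y - y') = B x y - B x y') ->
  (forall x y, `|B x y| <= `|x| * `|y|) ->
  f x @[x --> F] --> a -> g x @[x --> F] --> b -> B (f x) (g x) @[x --> F] --> B a b.
Proof.
move=> Bl Br Bb fa gb; apply/cvgrPdist_le => e e0.
pose M := `|a| + `|b| + 1.
have M0 : 0 < M by rewrite ltr_wpDl// addr_ge0.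
have e1 : 0 < Num.min 1 (e / (2 * M)) by rewrite lt_min ltr01 divr_gt0// mulr_gt0.
have fN := (iffLR (cvgrPdist_le _ _) fa) _ e1.
have gN := (iffLR (cvgrPdist_le _ _) gb) _ e1.
near=> x; have : `|a - f x| <= Num.min 1 (e / (2 * M)) by near: x; exact: fN.
have : `|b - g x| <= Num.min 1 (e / (2 * M)) by near: x; exact: gN.
rewrite !le_min => /andP[g1 g2] /andP[f1 f2].
have -> : B a b - B (f x) (g x) = B (a - f x) b + B (f x) (b - g x).
  by rewrite Bl Br addrA subrK.
rewrite (le_trans (ler_normD _ _))// (le_trans (lerD (Bb _ _) (Bb _ _)))//.
have fM : `|f x| <= M - `|b|.
  have := ler_normD (f x - a) a; rewrite subrK distrC => /le_trans; apply.
  by rewrite /M; lra.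
have eM : e = (e / (2 * M)) * M + (e / (2 * M)) * M.
  transitivity (e / (2 * M) * (2 * M)); first by rewrite divfK// gt_eqF// mulr_gt0.
  by rewrite (mulrC 2) mulrA mulrDr mulr1.
rewrite eM; have e2 : 0 <= e / (2 * M) by rewrite divr_ge0 ?mulr_ge0 ?ltW.
have h1 : `|a - f x| * `|b| <= e / (2 * M) * `|b| by rewrite ler_wpM2r.
have h2 : `|f x| * `|b - g x| <= (M - `|b|) * (e / (2 * M)) by rewrite ler_pM.
apply: (le_trans (lerD h1 h2)); rewrite (mulrC (M - _)) -mulrDr addrC subrK.
by rewrite lerDl mulr_ge0// ltW.
Unshelve. all: by end_near. Qed.

Lemma cvg_clin_apply (R : realType) (V W : normedModType R)
    (T : Type) (F : set_system T) {FF : Filter F} (f : T -> clin V W) (g : T -> V)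
    (a : clin V W) (b : V) :
  f x @[x --> F] --> a -> g x @[x --> F] --> b -> f x (g x) @[x --> F] --> a b.
Proof.
apply: (bounded_bilinear_cvg (B := fun (f : clin V W) v => f v)) => //.
- by move=> x y y'; rewrite linearB.
- by move=> x y; exact: clin_normP.
Qed.

Section SphereGeometry.
Context {R : realType} {E H : normedModType R}.
Context (ipH : {dot H for idfun}) (j : {linear E -> H}) (mu : R).
Hypotheses (ipH_norm : induces_norm ipH) (j_norm : forall u, `|j u| <= `|u|).
Hypothesis mu_gt0 : 0 < mu.

Local Notation "''[' u , v ]" := (ipH (j u) (j v)) : ring_scope.
Local Notation S := (Smu ipH j mu).

Lemma dotC u v : '[u, v] = '[v, u].
Proof. by rewrite (@hermitian_subproof _ _ _ _ ipH) /= expr0 mul1r. Qed.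

Lemma dotDl u v w : '[u + v, w] = '[u, w] + '[v, w].
Proof. by rewrite linearD/= linearDl. Qed.

Lemma dotZl a u w : '[a *: u, w] = a * '[u, w].
Proof. by rewrite linearZ/= linearZl_LR. Qed.

Lemma dotNl u w : '[- u, w] = - '[u, w].
Proof. by rewrite -scaleN1r dotZl mulN1r. Qed.

Lemma dotDr u v w : '[u, v + w] = '[u, v] + '[u, w].
Proof. by rewrite dotC dotDl dotC (dotC w). Qed.

Lemma dotZr a u w : '[u, a *: w] = a * '[u, w].
Proof. by rewrite dotC dotZl dotC. Qed.

Lemma dotNr u w : '[u, - w] = - '[u, w].
Proof. by rewrite dotC dotNl dotC. Qed.

Lemma dot_ge0 u : 0 <= '[u, u].
Proof. by rewrite ipH_norm sqr_ge0. Qed.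

Lemma dot_le u v : `|'[u, v]| <= `|u| * `|v|.
Proof.
have CS : '[u, v] ^+ 2 <= '[u, u] * '[v, v].
  have [v0|v0] := eqVneq '[v, v] 0.
    have jv : j v = 0 by apply/eqP; rewrite -normr_eq0 -sqrf_eq0 -ipH_norm v0.
    by rewrite v0 mulr0 jv linear0 expr0n.
  have vp : 0 < '[v, v] by rewrite lt_def v0 dot_ge0.
  have := dot_ge0 ('[v, v] *: u + (- '[u, v]) *: v).
  rewrite !dotDl !dotDr !dotZl !dotZr (dotC v u) => h.
  have : 0 <= '[v, v] * ('[u, u] * '[v, v] - '[u, v] ^+ 2) by lra.
  by rewrite pmulr_rge0// subr_ge0.
rewrite -(@ler_pXn2r _ 2)// ?nnegrE ?mulr_ge0//.
rewrite real_normK ?num_real// (le_trans CS)// exprMn !ipH_norm.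
by rewrite ler_pM ?sqr_ge0// ler_pXn2r ?nnegrE.
Qed.

Definition tanproj g d := d - ('[g, d] / mu) *: g.

(** For e tangent at a point g of the constraint, this is the point obtained by
    inverse stereographic projection.  It satisfies the constraint exactly, is
    a rational function of (g, e), and is tangent to g + e at order one. *)
Definition slide (g e : E) : E :=
  let k := '[e, e] / (4 * mu) in (1 + k)^-1 *: ((1 - k) *: g + e).

Definition retr g d := slide g (tanproj g d).

Lemma tanprojZ g a d : tanproj g (a *: d) = a *: tanproj g d.
Proof. by rewrite /tanproj dotZr scalerBr scalerA mulrA. Qed.

Lemma tanproj_tangent g d : S g -> '[g, tanproj g d] = 0.
Proof.
move=> gS; rewrite /tanproj dotDr dotNr dotZr.
by rewrite [X in _ * X]gS divfK ?subrr ?gt_eqF.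
Qed.

Lemma slide_curv_ge0 e : 0 <= '[e, e] / (4 * mu).
Proof. by rewrite divr_ge0 ?dot_ge0// mulr_ge0// ltW. Qed.

(** The squared length of (1 - k) g + e is ((1 - k)^2 + 4 k) mu = (1 + k)^2 mu. *)
Lemma slide_S g e : S g -> '[g, e] = 0 -> S (slide g e).
Proof.
rewrite /Smu/= => gS ge; rewrite /slide; set k := _ / _.
have k0 : 0 <= k by exact: slide_curv_ge0.
have eE : '[e, e] = 4 * mu * k by rewrite mulrC divfK// mulf_neq0// gt_eqF.
rewrite dotZl dotZr !dotDl !dotDr !dotZl !dotZr (dotC e) gS ge eE.
have k1 : 1 + k != 0 by rewrite gt_eqF// ltr_wpDr.
apply: (mulfI k1); rewrite mulVKf//; apply: (mulfI k1); rewrite mulVKf//.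
lra.
Qed.

Lemma retr_S g d : S g -> S (retr g d).
Proof. by move=> gS; apply: slide_S => //; exact: tanproj_tangent. Qed.

Lemma retr0 g : retr g 0 = g.
Proof.
have T0 : tanproj g 0 = 0 by rewrite /tanproj !linear0 mul0r scale0r subr0.
by rewrite /retr T0 /slide !linear0 !mul0r addr0 subr0 invr1 !scale1r addr0.
Qed.

Lemma retrN g d : retr (- g) (- d) = - retr g d.
Proof.
have tN : tanproj (- g) (- d) = - tanproj g d.
  by rewrite /tanproj dotNl dotNr opprK scalerN opprB opprK addrC.
by rewrite /retr tN /slide dotNl dotNr opprK scalerN -opprD scalerN.
Qed.

Lemma slide_sub g e (k := '[e, e] / (4 * mu)) :
  slide g e - g = (1 + k)^-1 *: (e - (2 * k) *: g).
Proof.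
have k0 : 0 <= k by exact: slide_curv_ge0.
have k1 : 1 + k != 0 by rewrite gt_eqF// ltr_wpDr.
apply: (scalerI k1); rewrite scalerBr /slide -/k !scalerA mulfV// !scale1r.
rewrite addrAC -scalerBl [LHS]addrC; congr (_ + _).
rewrite -[RHS]scaleNr; congr (_ *: _); lra.
Qed.

Lemma slide_sub_sub g e (k := '[e, e] / (4 * mu)) :
  slide g e - g - e = - ((1 + k)^-1 *: (k *: e + (2 * k) *: g)).
Proof.
have k0 : 0 <= k by exact: slide_curv_ge0.
have k1 : 1 + k != 0 by rewrite gt_eqF// ltr_wpDr.
rewrite slide_sub -/k; apply: (scalerI k1).
rewrite scalerN scalerBr !scalerA mulfV// !scale1r opprD.
by rewrite scalerDl scale1r opprD addrACA subrr add0r addrC.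
Qed.

Section Cvg.
Context (T : Type) (F : set_system T) {FF : Filter F}.

Lemma cvg_dot (f g : T -> E) a b : f x @[x --> F] --> a -> g x @[x --> F] --> b ->
  ('[f x, g x] : R^o) @[x --> F] --> ('[a, b] : R^o).
Proof.
apply: (bounded_bilinear_cvg (B := fun u v : E => ('[u, v] : R^o))) => //.
- by move=> x x' y; rewrite dotDl dotNl.
- by move=> x y y'; rewrite dotDr dotNr.
- exact: dot_le.
Qed.

Lemma cvg_tanproj (f g : T -> E) a b : f x @[x --> F] --> a -> g x @[x --> F] --> b ->
  tanproj (f x) (g x) @[x --> F] --> tanproj a b.
Proof.
move=> fa gb; apply: cvgB => //; apply: cvgZ => //.
by apply: cvgM; [exact: cvg_dot|exact: cvg_cst].
Qed.

Lemma cvg_retr (f g : T -> E) a b : f x @[x --> F] --> a -> g x @[x --> F] --> b ->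
  retr (f x) (g x) @[x --> F] --> retr a b.
Proof.
move=> fa gb; have tt := cvg_tanproj fa gb.
have kk : ('[tanproj (f x) (g x), tanproj (f x) (g x)] / (4 * mu)) @[x --> F]
   --> '[tanproj a b, tanproj a b] / (4 * mu).
  by apply: cvgM; [exact: cvg_dot|exact: cvg_cst].
rewrite /retr /slide; apply: cvgZ.
  apply: cvgV; last by apply: cvgD => //; exact: cvg_cst.
  by rewrite gt_eqF// ltr_wpDr// slide_curv_ge0.
apply: cvgD => //; apply: cvgZ => //; apply: cvgB => //; exact: cvg_cst.
Qed.

End Cvg.

Lemma tanproj_sum k (v : 'I_k -> E) (a : 'I_k -> R) g :
  tanproj g (\sum_i a i *: v i) = \sum_i a i *: tanproj g (v i).
Proof.
elim/big_ind2 : _ => [|x1 x2 y1 y2 <- <-|i _]; last by rewrite tanprojZ.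
  by have := tanprojZ g 0 0; rewrite !scale0r.
by rewrite /tanproj dotDr mulrDl scalerDl opprD addrACA.
Qed.

Section SecondOrder.
Variable phi : E -> R^o.
Hypothesis phi_C2 : C2 phi.

Variables (rad C : R).
Hypotheses (C_ge1 : 1 <= C) (radC : rad <= C) (muC : mu^-1 <= C).
Hypothesis bdD : D12_bounded phi (rad + 1) C.
Hypothesis ucD : D12_unif_continuous phi (rad + 1).

Lemma slide_curv_le e : '[e, e] / (4 * mu) <= C * `|e| ^+ 2 / 4.
Proof.
rewrite invfM mulrA mulrAC (mulrC C) ler_pM2r ?invr_gt0//.
rewrite ler_pM ?dot_ge0 ?invr_ge0 ?(ltW mu_gt0)//.
by rewrite (le_trans (ler_norm _))// expr2 dot_le.
Qed.

(** With h = slide g e - g, the term - 2 k phi'(g) g of phi'(g) h equals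
    - phi'(g) g |e|^2 / (2 mu): it is exactly the correction that turns
    phi''(g)[e, e] / 2 into D^2 phi (g)[e, e] / 2.  The other terms are of order
    |e|^3, except for the variation of phi'' along the segment, which is
    controlled by its uniform continuity. *)
Lemma slide_expansion eps : 0 < eps -> exists2 s0, 0 < s0 &
  forall g e, S g -> `|g| <= rad -> '[g, e] = 0 -> `|e| <= s0 ->
  phi (slide g e) <= phi g + (1 + '[e, e] / (4 * mu))^-1 * D1 phi g e
     + 2^-1 * Dsq ipH j phi g e e + eps * `|e| ^+ 2.
Proof.
move=> eps0; have e40 : 0 < eps / 4 by rewrite divr_gt0.
have [eta eta0 uc] := ucD e40.
have C0 : 0 < C by rewrite (lt_le_trans _ C_ge1).
have C4 : 0 < 4 * C ^+ 4 by rewrite mulr_gt0// exprn_gt0.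
exists (Num.min (Num.min (2^-1) (eta / 2)) (Num.min (C ^- 2) (eps / (4 * C ^+ 4)))).
  by rewrite !lt_min invr_gt0 ltr0n/= divr_gt0//= invr_gt0 exprn_gt0// divr_gt0.
move=> g e gS grad ge; rewrite !le_min => /andP[/andP[n12 neta] /andP[nC neps]].
set n := `|e| in n12 neta nC neps *; have n0 : 0 <= n by exact: normr_ge0.
set k := _ / (4 * mu).
have k0 : 0 <= k by exact: slide_curv_ge0.
have kle : k <= C * n ^+ 2 / 4 by exact: slide_curv_le.
have k1 : 0 < 1 + k by rewrite ltr_wpDr.
have kinv : (1 + k)^-1 <= 1 by rewrite invf_le1// lerDl.
have kinv0 : 0 < (1 + k)^-1 by rewrite invr_gt0.
have gC : `|g| <= C by exact: le_trans radC.
have nC2 : C ^+ 2 * n <= 1 by rewrite mulrC -ler_pdivlMr ?exprn_gt0// mul1r.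
have nC4 : 4 * C ^+ 4 * n <= eps by rewrite mulrC -ler_pdivlMr.
set h := slide g e - g.
have hE : h = (1 + k)^-1 *: (e - (2 * k) *: g) by exact: slide_sub.
have heE : h - e = - ((1 + k)^-1 *: (k *: e + (2 * k) *: g)).
  by exact: slide_sub_sub.
have Dk : Dsq ipH j phi g e e = D2 phi g e e - 4 * (k * D1 phi g g).
  rewrite /Dsq [X in _ / X]gS; congr (_ - _).
  have -> : '[e, e] = 4 * mu * k by rewrite mulrC divfK// mulf_neq0// gt_eqF.
  transitivity (4 * (k * D1 phi g g) * (mu^-1 * mu)); first by lra.
  by rewrite mulVf ?gt_eqF// mulr1.
have slideE : slide g e = g + h by rewrite addrC subrK.
clearbody k h.
have kg : 2 * k * `|g| <= C ^+ 2 * n ^+ 2 / 2.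
  apply: (@le_trans _ _ (2 * k * C)); first by rewrite ler_wpM2l ?mulr_ge0.
  apply: (@le_trans _ _ (2 * (C * n ^+ 2 / 4) * C)); last by lra.
  by rewrite ler_pM ?mulr_ge0// ?ler_pM// ltW.
have hn : `|h| <= 2 * n.
  rewrite hE normrZ gtr0_norm//.
  apply: (@le_trans _ _ (1 * `|e - (2 * k) *: g|)); first by rewrite ler_wpM2r.
  rewrite mul1r (le_trans (ler_normB _ _))// -/n normrZ ger0_norm ?mulr_ge0//.
  have : C ^+ 2 * n ^+ 2 <= n by rewrite expr2 mulrA ler_piMl.
  lra.
have hen : `|h - e| <= C ^+ 2 * n ^+ 2.
  rewrite heE normrN normrZ gtr0_norm//.
  apply: (@le_trans _ _ (1 * `|k *: e + (2 * k) *: g|)); first by rewrite ler_wpM2r.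
  rewrite mul1r (le_trans (ler_normD _ _))// -/n !normrZ.
  rewrite (ger0_norm k0) (ger0_norm (_ : 0 <= 2)) // -/n.
  have kn : k * n <= C * n ^+ 2 / 4 * 2^-1 by rewrite ler_pM.
  have : C * n ^+ 2 <= C ^+ 2 * n ^+ 2.
    by rewrite ler_wpM2r ?sqr_ge0// expr2 ler_peMr// ltW.
  lra.
have T : phi (slide g e) <= phi g + D1 phi g h
    + 2^-1 * (D2 phi g h h + eps / 4 * `|h| ^+ 2).
  rewrite slideE; apply: taylor2_le => // t /andP[t0 t1].
  have th : `|t *: h| <= `|h| by rewrite normrZ ger0_norm// ler_piMl.
  have h1 : `|h| <= 1 by lra.
  have g1 : `|g + t *: h| <= rad + 1.
    by rewrite (le_trans (ler_normD _ _))// lerD// (le_trans th).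
  have g2 : `|g| <= rad + 1 by rewrite (le_trans grad)// lerDl.
  have g3 : `|g + t *: h - g| <= eta by rewrite addrC addKr (le_trans th)//; lra.
  have /(_ h h)[_ hD] := uc _ _ g1 g2 g3; move: hD.
  rewrite -(mulrA (eps / 4)) -expr2 => /(le_trans (ler_norm _)).
  by rewrite lerBlDl.
have h2 : `|h| ^+ 2 <= 4 * n ^+ 2.
  by have := ler_pM (normr_ge0 h) (normr_ge0 h) hn hn; lra.
have rad1 : `|g| <= rad + 1 by rewrite (le_trans grad)// lerDl.
have D1g : D1 phi g h <= (1 + k)^-1 * D1 phi g e - 2 * k * D1 phi g g
     + C ^+ 4 * n ^+ 4 / 8.
  rewrite hE linearZ/= linearB/= linearZ/=.
  rewrite /GRing.scale/= mulrBr lerBlDr.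
  have -> : (1 + k)^-1 * (2 * k * D1 phi g g) = 
    2 * k * D1 phi g g - 2 * (k * (k * D1 phi g g)) * (1 + k)^-1.
    apply: (mulfI (lt0r_neq0 k1)).
    rewrite mulrBr mulVKf ?lt0r_neq0// [X in _ - X]mulrCA divff ?lt0r_neq0//; lra.
  have [D1gg _] := bdD g g rad1.
  have D1gg' : `|D1 phi g g| <= C ^+ 2.
    by rewrite (le_trans D1gg)// expr2 ler_pM2l.
  have : `|2 * (k * (k * D1 phi g g)) * (1 + k)^-1| <= C ^+ 4 * n ^+ 4 / 8.
    rewrite 4!normrM (ger0_norm k0) (gtr0_norm kinv0) ger0_norm//.
    apply: (@le_trans _ _ (2 * (k * (k * C ^+ 2)) * 1)).
      by rewrite ler_pM ?mulr_ge0 ?ler_pM ?mulr_ge0// ?ltW.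
    rewrite mulr1.
    have := ler_pM k0 k0 kle kle.
    rewrite -(ler_pM2r (exprn_gt0 2 C0)); lra.
  move=> /(le_trans (ler_norm _)); lra.
have D2g : D2 phi g h h <= D2 phi g e e + 3 * C ^+ 3 * n ^+ 3.
  have a1 : D2 phi g e (h - e) = D2 phi g e h - D2 phi g e e by rewrite linearB.
  have a2 : D2 phi g (h - e) h = D2 phi g h h - D2 phi g e h.
    by rewrite (linearB (D2 phi g)).
  have [_ /(le_trans (ler_norm _)) A1] := bdD e (h - e) rad1.
  have [_ /(le_trans (ler_norm _)) A2] := bdD (h - e) h rad1.
  have B1 : C * n * `|h - e| <= C * n * (C ^+ 2 * n ^+ 2).
    by rewrite ler_wpM2l// mulr_ge0// ltW.
  have B2 : C * `|h - e| * `|h| <= C * (C ^+ 2 * n ^+ 2) * (2 * n).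
    by rewrite ler_pM ?mulr_ge0 ?(ltW C0)// ler_pM2l.
  rewrite -/n in A1; lra.
have n4 : C ^+ 4 * n ^+ 4 <= eps / 4 * n ^+ 2.
  have : C ^+ 4 * n * (n * n ^+ 2) <= eps / 4 * (1 * n ^+ 2).
    apply: ler_pM; rewrite ?mulr_ge0 ?exprn_ge0 ?(ltW C0)//; first lra.
    by rewrite ler_wpM2r ?exprn_ge0//; lra.
  lra.
have n3 : C ^+ 3 * n ^+ 3 <= eps / 4 * n ^+ 2.
  have : C ^+ 4 * n * n ^+ 2 <= eps / 4 * n ^+ 2.
    by rewrite ler_wpM2r ?exprn_ge0//; lra.
  have : C ^+ 3 * n ^+ 3 <= C ^+ 4 * n ^+ 3.
    by rewrite ler_wpM2r ?exprn_ge0// ler_weXn2l.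
  lra.
rewrite Dk.
have := ler_wpM2l (ltW e40) h2.
have := mulr_ge0 (ltW eps0) (exprn_ge0 2 n0).
lra.
Qed.

Lemma tanproj_diff u0 g w : '[u0, w] = 0 -> `|g| <= rad -> `|w| <= 1 ->
  `|tanproj g w - w| <= C ^+ 2 * `|g - u0|.
Proof.
move=> uw grad w1; have C0 : 0 < C by rewrite (lt_le_trans _ C_ge1).
rewrite /tanproj addrAC subrr add0r normrN normrZ normrM.
have -> : '[g, w] = '[g - u0, w] by rewrite dotDl dotNl uw subr0.
have d1 : `|'[g - u0, w]| <= `|g - u0|.
  by rewrite (le_trans (dot_le _ _))// ler_piMr.
rewrite (gtr0_norm (_ : 0 < mu^-1)) ?invr_gt0//.
apply: (@le_trans _ _ (`|g - u0| * C * C)); last by lra.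
have gC : `|g| <= C by exact: le_trans radC.
by rewrite ler_pM ?mulr_ge0 ?invr_ge0 ?(ltW mu_gt0)// ler_pM ?invr_ge0 ?(ltW mu_gt0).
Qed.

Lemma Dsq_le g v w : S g -> `|g| <= rad ->
  `|Dsq ipH j phi g v w| <= 2 * C ^+ 3 * `|v| * `|w|.
Proof.
move=> gS grad; have C0 : 0 < C by rewrite (lt_le_trans _ C_ge1).
have rad1 : `|g| <= rad + 1 by rewrite (le_trans grad)// lerDl.
have gC : `|g| <= C by exact: le_trans radC.
have [_ D2g] := bdD v w rad1; have [D1g _] := bdD g w rad1.
rewrite /Dsq [X in _ / X]gS (le_trans (ler_normB _ _))//.
have vw0 : 0 <= `|v| * `|w| by rewrite mulr_ge0.
have A : `|D1 phi g g / mu * '[v, w]| <= C ^+ 3 * (`|v| * `|w|).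
  rewrite 2!normrM (gtr0_norm (_ : 0 < mu^-1)) ?invr_gt0//.
  rewrite ler_pM ?dot_le ?mulr_ge0 ?invr_ge0 ?(ltW mu_gt0)//.
  rewrite exprSr ler_pM ?invr_ge0 ?(ltW mu_gt0)// (le_trans D1g)//.
  by rewrite expr2 ler_pM2l.
have CC : C <= C ^+ 3 by rewrite -{1}(expr1 C) ler_weXn2l.
have := ler_wpM2r vw0 CC; lra.
Qed.

Lemma Dsq_unif_continuous eps : 0 < eps -> exists2 eta, 0 < eta &
  forall u g w, S u -> S g -> `|u| <= rad -> `|g| <= rad -> `|g - u| <= eta ->
  `|w| <= 1 -> Dsq ipH j phi g w w <= Dsq ipH j phi u w w + eps.
Proof.
move=> eps0; have C0 : 0 < C by rewrite (lt_le_trans _ C_ge1).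
have C3 : 0 < 3 * C ^+ 2 by rewrite mulr_gt0// exprn_gt0.
have e30 : 0 < eps / (3 * C ^+ 2) by rewrite divr_gt0.
have [eta eta0 uc] := ucD e30.
exists (Num.min eta (eps / (3 * C ^+ 2))); first by rewrite lt_min eta0.
move=> u g w uS gS urad grad; rewrite le_min => /andP[gu1 gu2] w1.
have urad1 : `|u| <= rad + 1 by rewrite (le_trans urad)// lerDl.
have grad1 : `|g| <= rad + 1 by rewrite (le_trans grad)// lerDl.
have gC : `|g| <= C by exact: le_trans radC.
set e3 := eps / _ in e30 uc gu2.
have ee : eps = e3 * (3 * C ^+ 2) by rewrite divfK// gt_eqF.
clearbody e3.
have ww1 : `|w| * `|w| <= 1 by rewrite mulr_ile1.
have [_ D2g] := uc _ _ grad1 urad1 gu1 w w.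
have [D1g _] := uc _ _ grad1 urad1 gu1 g w.
have [D1u _] := bdD (g - u) w urad1.
have A1 : D2 phi g w w <= D2 phi u w w + e3.
  rewrite -lerBlDl (le_trans (ler_norm _))// (le_trans D2g)// -mulrA.
  by rewrite ler_piMr// ltW.
have A2 : `|D1 phi u u - D1 phi g g| <= 2 * C * e3.
  have -> : D1 phi u u - D1 phi g g =
     - ((D1 phi g g - D1 phi u g) + D1 phi u (g - u)) by rewrite linearB/=; clra.
  rewrite normrN (le_trans (ler_normD _ _))//.
  have : e3 * `|g| <= e3 * C by rewrite ler_wpM2l// ltW.
  have : C * `|g - u| <= C * e3 by rewrite ler_pM2l.
  move: D1g D1u; clra.
have A3 : (D1 phi u u - D1 phi g g) / mu * '[w, w] <= 2 * C ^+ 2 * e3.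
  rewrite (le_trans (ler_norm _))// 2!normrM (gtr0_norm (_ : 0 < mu^-1)) ?invr_gt0//.
  have -> : 2 * C ^+ 2 * e3 = 2 * C * e3 * C * 1 by clra.
  rewrite ler_pM ?mulr_ge0 ?invr_ge0 ?(ltW mu_gt0)//.
    by rewrite ler_pM ?invr_ge0 ?(ltW mu_gt0).
  by rewrite (le_trans (dot_le _ _)).
have A4 : e3 <= C ^+ 2 * e3 by rewrite ler_peMl ?(ltW e30)// exprn_ege1.
rewrite /Dsq [X in _ - _ / X * _ <= _]gS [X in _ <= _ - _ / X * _ + _]uS.
move: A1 A3 A4 ee; clra.
Qed.

(** A step of length s from g in a direction w that is tangent at the nearby
    point u0.  Projecting w on the tangent space at g changes it by O(|g - u0|),
    so the first or second derivative of phi along it is still negative.  In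
    the first case the gain is of order s, which is more than s^2; in the second
    case the first derivative may contribute up to s tau. *)
Lemma descent del : 0 < del -> exists2 r0, 0 < r0 <= 1 &
  forall u0 g w s tau, S u0 -> S g -> `|u0| <= rad -> `|g| <= rad ->
    `|g - u0| <= r0 -> '[u0, w] = 0 -> `|w| <= 1 -> 0 <= s <= r0 -> 0 <= tau ->
    D1 phi u0 w <= - del \/
      Dsq ipH j phi u0 w w <= - del /\ D1 phi g (tanproj g w) <= tau ->
    phi (retr g (s *: w)) <= phi g + s * tau - del / 8 * s ^+ 2.
Proof.
move=> del0; have C0 : 0 < C by rewrite (lt_le_trans _ C_ge1).
have d40 : 0 < del / 4 by rewrite divr_gt0.
have [eta1 eta10 uc1] := ucD d40.
have [eta2 eta20 uc2] := Dsq_unif_continuous d40.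
have d320 : 0 < del / 32 by rewrite divr_gt0.
have [s0 s00 expn] := slide_expansion d320.
have C5 : 0 < 24 * C ^+ 5 by rewrite mulr_gt0// exprn_gt0.
have C3 : 0 < 32 * C ^+ 3 + del by rewrite addr_gt0// mulr_gt0// exprn_gt0.
exists (Num.min 1 (Num.min (Num.min eta1 eta2) (Num.min (s0 / 2)
   (Num.min (C ^- 2) (Num.min (del / (24 * C ^+ 5)) (del / (8 * (32 * C ^+ 3 + del)))))))).
  rewrite ge_min lexx/= !lt_min ltr01 eta10 eta20 !divr_gt0 ?invr_gt0 ?exprn_gt0//.
  by rewrite mulr_gt0.
set r0 := Num.min 1 _.
move=> u0 g w s tau uS gS urad grad gur uw w1 /andP[sp sr] tau0 bad.
have : r0 <= r0 by [].
rewrite {2}/r0 !le_min.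
move=> /andP[r1 /andP[/andP[reta1 reta2] /andP[rs0 /andP[rC2 /andP[rC5 rC3]]]]].
clearbody r0.
have r00 : 0 <= r0 by rewrite (le_trans sp).
have {}rC2 : C ^+ 2 * r0 <= 1 by rewrite mulrC -ler_pdivlMr ?exprn_gt0// mul1r.
have {}rC5 : 24 * C ^+ 5 * r0 <= del by rewrite mulrC -ler_pdivlMr.
have {}rC3 : 8 * (32 * C ^+ 3 + del) * r0 <= del.
  by rewrite mulrC -ler_pdivlMr// mulr_gt0.
have urad1 : `|u0| <= rad + 1 by rewrite (le_trans urad)// lerDl.
have grad1 : `|g| <= rad + 1 by rewrite (le_trans grad)// lerDl.
set w' := tanproj g w.
have w'w : `|w' - w| <= C ^+ 2 * r0.
  by rewrite (le_trans (tanproj_diff uw grad w1))// ler_wpM2l// exprn_ge0// ltW.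
have w'2 : `|w'| <= 2.
  by rewrite -(subrK w w') (le_trans (ler_normD _ _))//; lra.
have s1 : s <= 1 by lra.
have sw' : `|s *: w'| <= s * 2 by rewrite normrZ ger0_norm// ler_wpM2l.
have := expn g (s *: w') gS grad _ _.
rewrite dotZr tanproj_tangent// mulr0 => /(_ erefl).
have sw's0 : `|s *: w'| <= s0 by lra.
move=> /(_ sw's0); rewrite /retr tanprojZ.
have kle := slide_curv_le (s *: w').
have := slide_curv_ge0 (s *: w').
set k := '[_, _] / _ in kle * => k0.
have DsqZ : Dsq ipH j phi g (s *: w') (s *: w') = s ^+ 2 * Dsq ipH j phi g w' w'.
  have D2Z : D2 phi g (s *: w') (s *: w') = s * (s * D2 phi g w' w').
    have -> : D2 phi g (s *: w') = s *: D2 phi g w' by rewrite linearZ.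
    by rewrite clinZ linearZ.
  rewrite /Dsq dotZl dotZr D2Z; clra.
have D1Z : D1 phi g (s *: w') = s * D1 phi g w' by rewrite linearZ.
rewrite DsqZ D1Z.
clearbody k.
have sw2 : `|s *: w'| ^+ 2 <= 4 * s ^+ 2.
  by have := ler_pM (normr_ge0 _) (normr_ge0 _) sw' sw'; lra.
have k1 : 0 < 1 + k by rewrite ltr_wpDr.
have kinv : (1 + k)^-1 <= 1 by rewrite invf_le1// lerDl.
have kinv0 : 0 < (1 + k)^-1 by rewrite invr_gt0.
have e4 := ler_wpM2l (ltW d320) sw2.
have s20 : 0 <= s ^+ 2 by exact: sqr_ge0.
case: bad => [D1u|[Du Dg]] key.
- have D1g : D1 phi g w' <= - (del / 2).
    have [] := uc1 g u0 grad1 urad1 (le_trans gur reta1) w w.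
    move=> /(le_trans (ler_norm _)) a1 _.
    have [/(le_trans (ler_norm _)) a2 _] := bdD (w' - w) w grad1.
    have a2' : D1 phi g (w' - w) <= C ^+ 3 * r0.
      by rewrite (le_trans a2)// exprS -mulrA ler_pM2l.
    rewrite linearB/= in a2'.
    have : C ^+ 3 * r0 <= C ^+ 5 * r0 by rewrite ler_wpM2r// ler_weXn2l.
    have : del / 4 * `|w| <= del / 4 by rewrite ler_piMr// ltW.
    have : 0 <= C ^+ 5 * r0 by rewrite mulr_ge0// exprn_ge0// ltW.
    clra.
  have kle1 : k <= 1.
    rewrite (le_trans kle)//.
    have : C * `|s *: w'| ^+ 2 <= C * (4 * s ^+ 2) by rewrite ler_pM2l.
    have : C * s * s <= C ^+ 2 * r0 * 1.
      rewrite ler_pM ?mulr_ge0 ?(ltW C0)//.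
      by rewrite ler_pM ?(ltW C0)// expr2 ler_peMr// ltW.
    clra.
  have kinv2 : 2^-1 <= (1 + k)^-1 by rewrite lef_pV2 ?posrE//; clra.
  have b1 : (1 + k)^-1 * (s * D1 phi g w') <= 2^-1 * (s * - (del / 2)).
    have c1 : s * (del / 2) <= s * - D1 phi g w' by rewrite ler_wpM2l// lerNr.
    have c2 : 2^-1 * (s * (del / 2)) <= (1 + k)^-1 * (s * - D1 phi g w').
      by rewrite ler_pM// mulr_ge0// divr_ge0// ltW.
    move: c2; rewrite !mulrN; clra.
  have b2 : Dsq ipH j phi g w' w' <= 8 * C ^+ 3.
    rewrite (le_trans (ler_norm _))// (le_trans (Dsq_le w' w' gS grad))//.
    have : `|w'| * `|w'| <= 2 * 2 by rewrite ler_pM.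
    have C30 : 0 <= 2 * C ^+ 3 by rewrite mulr_ge0// exprn_ge0// ltW.
    by move=> /(ler_wpM2l C30); clra.
  have b3 := ler_wpM2l s20 b2.
  have b4 : (32 * C ^+ 3 + del) * s * s <= del / 8 * s.
    rewrite ler_wpM2r// (le_trans _ (_ : (32 * C ^+ 3 + del) * r0 <= _))//; last by clra.
    by rewrite ler_wpM2l// ltW.
  have b5 : 0 <= s * tau by rewrite mulr_ge0.
  have b6 : del * s ^+ 2 <= del * s by rewrite ler_pM2l// expr2 ler_piMr.
  have b7 : 0 <= C ^+ 3 * s ^+ 2 by rewrite mulr_ge0// exprn_ge0// ltW.
  have b8 : 0 <= del * s ^+ 2 by rewrite mulr_ge0// ltW.
  clra.
- have b1 : (1 + k)^-1 * (s * D1 phi g w') <= s * tau.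
    apply: (@le_trans _ _ ((1 + k)^-1 * (s * tau))).
      by rewrite ler_pM2l// ler_wpM2l.
    by rewrite ler_piMl// mulr_ge0.
  have b2 : Dsq ipH j phi g w' w' <= - (del / 2).
    have a1 := uc2 u0 g w uS gS urad grad (le_trans gur reta2) w1.
    have a2 := le_trans (ler_norm _) (Dsq_le (w' - w) w' gS grad).
    have a3 := le_trans (ler_norm _) (Dsq_le w (w' - w) gS grad).
    have C30 : 0 <= 2 * C ^+ 3 by rewrite mulr_ge0// exprn_ge0// ltW.
    have a4 : 2 * C ^+ 3 * `|w' - w| * `|w'| <= 2 * C ^+ 3 * (C ^+ 2 * r0) * 2.
      by apply: ler_pM => //; [apply: mulr_ge0|rewrite ler_wpM2l].
    have a5 : 2 * C ^+ 3 * `|w| * `|w' - w| <= 2 * C ^+ 3 * 1 * (C ^+ 2 * r0).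
      by apply: ler_pM => //; [apply: mulr_ge0|rewrite ler_wpM2l].
    have : Dsq ipH j phi g w' w' = Dsq ipH j phi g w w +
       Dsq ipH j phi g (w' - w) w' + Dsq ipH j phi g w (w' - w).
      have c1 : D2 phi g w (w' - w) = D2 phi g w w' - D2 phi g w w by rewrite linearB.
      have c2 : D2 phi g (w' - w) w' = D2 phi g w' w' - D2 phi g w w'.
        by rewrite (linearB (D2 phi g)).
      by rewrite /Dsq dotDl dotDr dotNl dotNr c1 c2; clra.
    clra.
  have b3 := ler_wpM2l s20 b2.
  clra.
Qed.

(** * Odd deformations of curves *)

(** A Lipschitz constant of the displacement made by [retr]. *)
Definition drift := 2 * C ^+ 3 + 2 * C ^+ 8.

Lemma drift_ge1 : 1 <= drift.
Proof.
have : 1 <= C ^+ 3 by rewrite exprn_ege1.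
have : 0 <= C ^+ 8 by rewrite exprn_ge0// (le_trans _ C_ge1).
rewrite /drift; lra.
Qed.

Lemma retr_dist g d : `|g| <= rad -> `|d| <= 1 -> `|retr g d - g| <= drift * `|d|.
Proof.
move=> grad d1; have C0 : 0 < C by rewrite (lt_le_trans _ C_ge1).
have gC : `|g| <= C by exact: le_trans radC.
have e1 : `|tanproj g d| <= 2 * C ^+ 3 * `|d|.
  rewrite (le_trans (ler_normB _ _))// normrZ normrM (gtr0_norm (_ : 0 < mu^-1)) ?invr_gt0//.
  have h1 : `|'[g, d]| <= C * `|d|.
    by rewrite (le_trans (dot_le _ _))// ler_wpM2r.
  have h2 : `|'[g, d]| / mu * `|g| <= C * `|d| * C * C.
    by rewrite ler_pM ?mulr_ge0 ?invr_ge0 ?(ltW mu_gt0)// ler_pM ?invr_ge0 ?(ltW mu_gt0).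
  have : 1 * `|d| <= C ^+ 3 * `|d| by rewrite ler_wpM2r// exprn_ege1.
  lra.
rewrite /retr slide_sub//; set e := tanproj g d in e1 *.
have := slide_curv_le e.
have := slide_curv_ge0 e.
move: (_ / (4 * mu)) => k k0 kle.
have k1 : 0 < 1 + k by rewrite ltr_wpDr.
rewrite normrZ gtr0_norm ?invr_gt0//.
apply: (@le_trans _ _ (1 * `|e - (2 * k) *: g|)).
  by rewrite ler_wpM2r// invf_le1// lerDl.
rewrite mul1r (le_trans (ler_normB _ _))// normrZ ger0_norm ?mulr_ge0//.
have h1 : `|e| ^+ 2 <= (2 * C ^+ 3 * `|d|) ^+ 2.
  by rewrite ler_pXn2r ?nnegrE// (le_trans _ e1).
have h2 : C * `|e| ^+ 2 <= C * (2 * C ^+ 3 * `|d|) ^+ 2 by rewrite ler_pM2l.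
have h3 : 2 * k * `|g| <= 2 * (C * (2 * C ^+ 3 * `|d|) ^+ 2 / 4) * C.
  rewrite ler_pM ?mulr_ge0// ler_pM2l// (le_trans kle)//; lra.
have h4 : `|d| ^+ 2 <= `|d| by rewrite expr2 ler_piMr.
have h5 : C ^+ 8 * `|d| ^+ 2 <= C ^+ 8 * `|d|.
  by rewrite ler_wpM2l// exprn_ge0// ltW.
rewrite /drift; lra.
Qed.

Variable n : nat.
Local Notation P := (R * 'rV[R]_n)%type.
Local Notation K := (@cylinder R n).

Definition odd_curve (g : P -> E) := [/\ {within K, continuous g},
  forall p, K p -> S (g p) & forall p, K p -> g (antipode p) = - g p].

(** The second alternative is stated on a basis: the span of v is a space of
    tangent vectors, of dimension larger than that of the cylinder, on which
    the quadratic form is below - del. *)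
Definition descent_point (del : R) (u0 : E) :=
  (exists w, [/\ '[u0, w] = 0, `|w| <= 1 & D1 phi u0 w <= - del]) \/
  (exists k (v : 'I_k -> E), [/\ (n.+1 < k)%N, lin_indep v &
     forall a : 'I_k -> R, let w := \sum_i a i *: v i in '[u0, w] = 0 /\
       (w != 0 -> Dsq ipH j phi u0 w w < - del * `|w| ^+ 2)]).

(** One field w defined on the whole cylinder, although it is useful only at
    the parameters p with g p close to u0. *)
Lemma descent_field del : 0 < del -> exists2 r0, 0 < r0 <= 1 &
  forall u0 g tau, S u0 -> `|u0| <= rad -> descent_point del u0 ->
    {within K, continuous g} -> (forall p, K p -> S (g p)) -> 0 < tau ->
  exists w : P -> E, [/\ {within K, continuous w}, (forall p, K p -> `|w p| <= 1) &
    forall p s, K p -> `|g p| <= rad -> `|g p - u0| <= r0 -> 0 <= s <= r0 ->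
      phi (retr (g p) (s *: w p)) <= phi (g p) + s * tau - del / 8 * s ^+ 2].
Proof.
move=> del0; have [r0 r01 dsc] := descent del0.
exists r0 => // u0 g tau uS urad bad gc gS tau0.
case: bad => [[w [uw w1 Dw]]|[k [v [nk vI vu]]]].
  exists (fun=> w); split => //; first by move=> x; exact: cvg_cst.
  by move=> p s Kp grad gu s01; apply: (dsc u0) => //; [exact: gS|exact: ltW|left].
pose l (i : 'I_k) (p : P) : R := D1 phi (g p) (tanproj (g p) (v i)).
have lc i : {within K, continuous (l i)}.
  move=> x; apply: cvg_clin_apply; last by apply: cvg_tanproj; [exact: gc|exact: cvg_cst].
  apply: (continuous_comp (gc x)); apply: differentiable_continuous.
  by case: phi_C2.
have [w [wc wP]] := direction_field cylinder_compact cylinder_coord nk vI lc tau0.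
exists w; split => //.
  by move=> p /wP[a [_ -> _]].
move=> p s Kp grad gu s01; have [a [wE w1 al]] := wP p Kp.
have [uw Dw] := vu a; rewrite -wE in uw Dw.
apply: (dsc u0) => //; [exact: gS|by rewrite w1|exact: ltW|right; split].
  have : w p != 0 by rewrite -normr_gt0 w1.
  by move=> /Dw; rewrite w1 expr1n mulr1 => /ltW.
by rewrite wE tanproj_sum linear_sum/=; under eq_bigr do rewrite linearZ.
Qed.

Hypothesis phi_even : forall u, S u -> phi (- u) = phi u.

(** The displacement chi w is used on the support of chi, its odd reflection on
    the antipodal set, and these two sets are disjoint.  As phi is even on the
    constraint, the estimate on the support gives the one on its antipode. *)
Lemma odd_step del : 0 < del -> exists2 r0, 0 < r0 <= 1 &
  forall r u0 g (chi : P -> R) tau, 0 <= r <= r0 -> S u0 -> `|u0| <= rad ->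
    descent_point del u0 -> odd_curve g -> {within K, continuous chi} ->
    (forall p, 0 <= chi p <= 1) ->
    (forall p, K p -> chi p != 0 -> chi (antipode p) = 0) ->
    (forall p, K p -> chi p != 0 -> `|g p| <= rad /\ `|g p - u0| <= r0) -> 0 < tau ->
  exists g', odd_curve g' /\ forall p, K p ->
    [/\ chi p = 0 -> chi (antipode p) = 0 -> g' p = g p,
        `|g' p - g p| <= drift * r, phi (g' p) <= phi (g p) + tau &
        chi p = 1 -> phi (g' p) <= phi (g p) + tau - del / 8 * r ^+ 2].
Proof.
move=> del0.
have [r0 /andP[r00 r01] field] := descent_field del0.
exists r0; first by rewrite r00.
move=> r u0 g chi tau /andP[rp rr0] uS urad bad [gc gS gN] chic chi01 chiN gnear tau0.
have [w [wc w1 wP]] := field u0 g tau uS urad bad gc gS tau0.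
have r1 : r <= 1 by exact: le_trans r01.
have drift0 : 0 <= drift by rewrite (le_trans ler01)// drift_ge1.
pose d p := (r * chi p) *: w p - (r * chi (antipode p)) *: w (antipode p).
have dc : {within K, continuous d}.
  have cN := within_continuous_antipode (chic : {within K, continuous (chi : P -> R^o)}).
  have wN := within_continuous_antipode wc.
  move=> x; apply: cvgB; apply: cvgZ; [|exact: wc| |exact: wN].
    by apply: cvgM; [exact: cvg_cst|exact: chic].
  by apply: cvgM; [exact: cvg_cst|exact: cN].
have dN p : d (antipode p) = - d p by rewrite /d antipodeK opprB.
pose g' p := retr (g p) (d p).
have g'N p : K p -> g' (antipode p) = - g' p.
  by move=> Kp; rewrite /g' dN gN// retrN.
have g'c : odd_curve g'.
  split => //; last by move=> p Kp; apply: retr_S => //; exact: gS.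
  by move=> x; apply: cvg_retr => //; [exact: gc|exact: dc].
have key p : K p -> chi p != 0 -> `|g' p - g p| <= drift * r /\
    phi (g' p) <= phi (g p) + tau - del / 8 * (r * chi p) ^+ 2.
  move=> Kp cp; have [grad gu] := gnear p Kp cp.
  have /andP[c0 c1] := chi01 p.
  have s0 : 0 <= r * chi p by rewrite mulr_ge0.
  have sr : r * chi p <= r by rewrite ler_piMr.
  have dE : d p = (r * chi p) *: w p.
    by rewrite /d (chiN p Kp cp) mulr0 scale0r subr0.
  have dr : `|d p| <= r.
    rewrite dE normrZ ger0_norm// (le_trans _ sr)// ler_piMr//; exact: w1.
  split.
    rewrite (le_trans (retr_dist grad _))//.
      exact: le_trans r1.
    by rewrite ler_wpM2l.
  rewrite /g' dE (le_trans (wP p _ Kp grad gu _))//.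
    by rewrite s0 (le_trans sr).
  by rewrite lerD2r lerD2l ler_piMl ?(ltW tau0)// (le_trans sr).
have sq0 (x : R) : 0 <= del / 8 * x ^+ 2 by rewrite mulr_ge0 ?sqr_ge0// divr_ge0// ltW.
have gle (x y : R) : 0 <= y -> x + tau - y <= x + tau by move=> y0; rewrite lerBlDr lerDl.
exists g'; split => // p Kp.
have [cp|cp] := eqVneq (chi p) 0; last first.
  have [k1 k2] := key p Kp cp; split => //.
  - by move=> c0; rewrite c0 eqxx in cp.
  - by rewrite (le_trans k2)// gle.
  - by move=> c1; rewrite c1 mulr1 in k2.
have cp1 (Q : Prop) : chi p = 1 -> Q.
  by move=> c1; move: cp; rewrite c1 => /eqP; rewrite oner_eq0.
have [cq|cq] := eqVneq (chi (antipode p)) 0; last first.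
  have [k1 k2] := key _ (antipode_cylinder Kp) cq.
  move: k1 k2; rewrite g'N// gN// -opprD normrN => k1 k2; split => //.
  - by move=> _ c0; rewrite c0 eqxx in cq.
  - rewrite !phi_even in k2; [|exact: gS|by case: g'c => _ + _; apply].
    by rewrite (le_trans k2)// gle.
  - exact: cp1.
have gg : g' p = g p by rewrite /g' /d cp cq !mulr0 !scale0r subr0 retr0.
split; rewrite ?gg ?subrr ?normr0 ?mulr_ge0 ?lerDl ?(ltW tau0)//; exact: cp1.
Qed.

Definition moved (T : Type) (chi : T -> P -> R) (p : P) : pred T :=
  fun i => (chi i p != 0) || (chi i (antipode p) != 0).

(** Iteration of [odd_step] over the sequence s.  A parameter is moved by at
    most M of the steps, so by at most drift * r * M <= r0 / 2 in all, and the
    neighbourhood of radius r0 of u i required by step i is never left; this is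
    why r depends on M and not on the length of s. *)
Lemma deform_seq del : 0 < del -> exists2 r0, 0 < r0 <= 1 &
  forall (T : eqType) (s : seq T) (chi : T -> P -> R) (u : T -> E) gam r M tau,
    0 <= r <= r0 -> drift * r * M%:R <= r0 / 2 -> odd_curve gam -> 0 < tau ->
    (forall i, i \in s -> [/\ S (u i), `|u i| <= rad - 1 & descent_point del (u i)]) ->
    (forall i, i \in s -> {within K, continuous (chi i)}) ->
    (forall i, i \in s -> forall p, 0 <= chi i p <= 1) ->
    (forall i, i \in s -> forall p, K p -> chi i p != 0 -> chi i (antipode p) = 0) ->
    (forall i, i \in s -> forall p, K p -> chi i p != 0 -> `|gam p - u i| <= r0 / 2) ->
    (forall p, K p -> (count (moved chi p) s <= M)%N) ->
  exists g, odd_curve g /\ forall p, K p ->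
    [/\ `|g p - gam p| <= drift * r * (count (moved chi p) s)%:R,
        phi (g p) <= phi (gam p) + tau * (size s)%:R &
        forall i, i \in s -> chi i p = 1 ->
          phi (g p) <= phi (gam p) + tau * (size s)%:R - del / 8 * r ^+ 2].
Proof.
move=> del0; have [r0 /andP[r00 r01] step] := odd_step del0.
exists r0; first by rewrite r00.
move=> T s chi u gam r M tau /andP[rp rr0] rM gamc tau0.
have drift0 : 0 <= drift by rewrite (le_trans ler01)// drift_ge1.
have dr0 : 0 <= drift * r by rewrite mulr_ge0.
elim: s => [|i s IH] us chic chi01 chiN gamnear cM.
  exists gam; split => // p Kp; split => //=; first by rewrite mulr0 subrr normr0.
  by rewrite mulr0 addr0.
have [||||||g [gc gP]] := IH.
- by move=> k ks; apply: us; rewrite inE ks orbT.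
- by move=> k ks; apply: chic; rewrite inE ks orbT.
- by move=> k ks; apply: chi01; rewrite inE ks orbT.
- by move=> k ks; apply: chiN; rewrite inE ks orbT.
- by move=> k ks; apply: gamnear; rewrite inE ks orbT.
- by move=> p Kp; rewrite (leq_trans _ (cM p Kp))//= leq_addl.
have is_ : i \in i :: s by rewrite inE eqxx.
have [uS urad bad] := us i is_.
have near_g p : K p -> chi i p != 0 -> `|g p| <= rad /\ `|g p - u i| <= r0.
  move=> Kp cp; have [gg _ _] := gP p Kp; have gu := gamnear i is_ p Kp cp.
  have gg2 : `|g p - gam p| <= r0 / 2.
    rewrite (le_trans gg)// (le_trans _ rM)// ler_wpM2l// ler_nat.
    by rewrite (leq_trans _ (cM p Kp))//= leq_addl.
  have gur : `|g p - u i| <= r0.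
    rewrite -(subrKA (gam p)) (le_trans (ler_normD _ _))//.
    by rewrite [leRHS]splitr lerD.
  split => //; rewrite -(subrK (u i) (g p)) (le_trans (ler_normD _ _))//.
  by move: (le_trans gur r01) urad => h1 h2; rewrite (le_trans (lerD h1 h2))// addrC subrK.
have urad' : `|u i| <= rad by rewrite (le_trans urad)// gerBl.
have [g' [g'c g'P]] := step r (u i) g (chi i) tau
  (introT andP (conj rp rr0)) uS urad' bad gc (chic i is_) (chi01 i is_) (chiN i is_) near_g tau0.
exists g'; split => // p Kp; have [a1 a2 a3] := gP p Kp; have [b0 b1 b2 b3] := g'P p Kp.
rewrite /= -natr1 mulrDr mulr1; split.
- rewrite natrD mulrDr -(subrKA (g p)) (le_trans (ler_normD _ _))// lerD//.
  rewrite /moved; case: eqVneq => [c0|c0]/=; last by rewrite mulr1.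
  case: eqVneq => [c1|c1]/=; last by rewrite mulr1.
  by rewrite b0// subrr normr0 mulr0.
- by rewrite (le_trans b2)// addrA lerD2r.
- move=> k; rewrite inE => /orP[/eqP -> c1|ks c1].
    by rewrite (le_trans (b3 c1))// addrA lerD2r lerD2r.
  by rewrite (le_trans b2)//; have := a3 k ks c1; lra.
Qed.

(** The decrease eta = del/8 * r^2 depends only on del, on the bounds of phi on
    the ball and on n.  The mesh eps is chosen from the moduli of continuity of
    gam and of phi o gam, and only the cubes that meet the superlevel set
    { a <= phi o gam } are processed, each with the value of gam at a point of
    that set as centre: so nothing moves where phi o gam is below a - e1. *)
Lemma deformation del : 0 < del -> exists2 eta, 0 < eta &
  forall gam a e1, odd_curve gam -> 0 < e1 ->
    (forall p, K p -> a <= phi (gam p) -> `|gam p| <= rad - 1 /\ descent_point del (gam p)) ->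
  exists g, odd_curve g /\ forall p, K p ->
    [/\ phi (g p) <= phi (gam p) + e1,
        a <= phi (gam p) -> phi (g p) <= phi (gam p) + e1 - eta &
        phi (gam p) <= a - e1 -> g p = gam p].
Proof.
move=> del0.
have [r0 /andP[r00 r01] dseq] := deform_seq del0.
(* a parameter moves with the cubes around it and with those around its antipode *)
pose M := (2 ^ n.+2)%N.
have dr1 : 1 <= drift := drift_ge1.
have M1 : 1 <= M%:R :> R by rewrite ler1n expn_gt0.
have dM : 1 <= drift * M%:R by rewrite -[X in X <= _]mulr1 ler_pM.
have ME : M = (2 ^ n.+2)%N by [].
clearbody M.
pose r := r0 / (2 * (drift * M%:R)).
have dM0 : 0 < drift * M%:R by rewrite (lt_le_trans _ dM).
have r_gt0 : 0 < r by rewrite divr_gt0// mulr_gt0.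
have rr0 : 0 <= r <= r0.
  by rewrite (ltW r_gt0)/= ler_piMr ?(ltW r00)// invf_le1 ?mulr_gt0//; lra.
have rM : drift * r * M%:R <= r0 / 2.
  by rewrite (mulrC drift) -mulrA /r invfM [r0 * _]mulrA divfK ?gt_eqF.
exists (del / 8 * r ^+ 2); first by rewrite mulr_gt0 ?exprn_gt0// divr_gt0.
clearbody r.
move=> gam a e1 gamc e10 hi; have [gc gS gN] := gamc.
have phic : {within K, continuous (phi \o gam)}.
  move=> x; apply: (continuous_comp (gc x)); apply: differentiable_continuous.
  by case: phi_C2.
have r02 : 0 < r0 / 2 by rewrite divr_gt0.
have [d1 d10 uc1] := compact_unif_continuous (cylinder_compact (n := n)) gc r02.
have [d2 d20 uc2] := compact_unif_continuous (cylinder_compact (n := n)) phic e10.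
pose eps := Num.min (Num.min (d1 / 3) (d2 / 3)) (2 * n.+1%:R)^-1.
have eps0 : 0 < eps by rewrite !lt_min !divr_gt0 ?invr_gt0 ?mulr_gt0.
have : eps <= eps by []; rewrite {2}/eps !le_min => /andP[/andP[eps1 eps2] eps3].
clearbody eps.
have [T [c [cov mult]]] := grid_cover (n := n) eps0.
pose good (i : T) := `[< exists p, [/\ K p, `|p - c i| <= eps & a <= phi (gam p)] >].
have /choice[pt ptP] : forall i, exists p, good i ->
    [/\ K p, `|p - c i| <= eps & a <= phi (gam p)].
  move=> i; have [/asboolP[p pP]|] := boolP (good i); first by exists p.
  by move=> _; exists 0.
pose s := [seq i <- enum T | good i].
have sgood i : i \in s -> good i by rewrite mem_filter => /andP[].
pose chi i := bump (c i) eps.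
have close i p : i \in s -> chi i p != 0 -> `|p - pt i| < 3 * eps.
  move=> /sgood/ptP[_ pc _] /(bump_neq0 eps0) h.
  rewrite -(subrKA (c i)) (le_lt_trans (ler_normD _ _))// (distrC (c i)).
  by move: h pc; lra.
have chiN i p : K p -> chi i p != 0 -> chi i (antipode p) = 0.
  move=> Kp /(bump_neq0 eps0) h; apply/eqP/negPn/negP => /(bump_neq0 eps0) h'.
  have := antipode_far Kp eps3; apply/negP; rewrite -ltNge.
  rewrite -(subrKA (c i)) (le_lt_trans (ler_normD _ _))// (distrC (c i)).
  by move: h h'; lra.
have cM p : K p -> (count (moved chi p) s <= M)%N.
  move=> Kp; rewrite ME expnS mul2n -addnn.
  have cnt (q : P) : (count (fun i => chi i q != 0%R) s <= 2 ^ n.+1)%N.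
    rewrite (leq_trans _ (mult q))// cardE /enum_mem size_filter count_filter enumT.
    by apply: sub_count => i /andP[/(bump_neq0 eps0)].
  rewrite (leq_trans _ (leq_add (cnt p) (cnt (antipode p))))//.
  by rewrite -count_predUI; apply: leq_addr.
have tau0 : 0 < e1 / (size s).+1%:R by rewrite divr_gt0.
have [||||||g [gc' gP]] := dseq T s chi (gam \o pt) gam r M (e1 / (size s).+1%:R) rr0 rM gamc tau0.
- by move=> i /sgood/ptP[Kp pc ap]; have [h1 h2] := hi _ Kp ap; split => //; exact: gS.
- by move=> i _; apply: continuous_subspaceT; exact: bump_continuous.
- by move=> i _ p; exact: bump01.
- by move=> i _ p; exact: chiN.
- move=> i is_ p Kp cp; have := close i p is_ cp => h; apply: ltW; apply: uc1 => //.
    by have [] := ptP i (sgood i is_).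
  by move: h eps1; lra.
- exact: cM.
have taue : e1 / (size s).+1%:R * (size s)%:R <= e1.
  by rewrite -mulrA ler_piMr ?(ltW e10)// ler_pdivrMl// mulr1 ler_nat.
exists g; split => // p Kp; have [g1 g2 g3] := gP p Kp; split.
- by rewrite (le_trans g2)// lerD2l.
- move=> ap; have [i pi] := cov p (fun o => cylinder_coord o Kp).
  have is_ : i \in s by rewrite mem_filter mem_enum andbT; apply/asboolP; exists p.
  have := g3 i is_ (bump_eq1 eps0 pi); move: taue.
  by move: (e1 / _ * _) => x h1 h2; lra.
- move=> ap; have unmoved q : K q -> phi (gam q) <= a - e1 -> ~~ has (fun i => chi i q != 0) s.
    move=> Kq aq; apply/hasPn => i is_; apply/negP => cq.
    have [Kpt _ apt] := ptP i (sgood i is_).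
    have : `|q - pt i| < d2 by have := close i q is_ cq; move: eps2; lra.
    move=> /(uc2 _ _ Kq Kpt); rewrite ltr_norml => /andP[h _].
    have {}h : - e1 < phi (gam q) - phi (gam (pt i)) by [].
    by move: aq apt h; lra.
  have c0 : count (moved chi p) s = 0%N.
    apply/eqP; rewrite -leqn0 leqNgt -has_count; apply/negP => /hasP[i is_ /orP[|]] h.
      by have /hasPn/(_ i is_) := unmoved p Kp ap; rewrite h.
    have /hasPn/(_ i is_) : ~~ has (fun i => chi i (antipode p) != 0) s.
      by apply: unmoved; [exact: antipode_cylinder|rewrite gN// phi_even//; exact: gS].
    by rewrite h.
  by move: g1; rewrite c0 mulr0 normr_le0 subr_eq0 => /eqP.
Qed.

End SecondOrder.

End SphereGeometry.

(** * Left difference quotients of a monotone function *)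

Section LeftSlopes.
Context {R : realType}.
Local Notation mu := (@lebesgue_measure R).

Lemma limn_einf_lt_frequently (u : (\bar R)^nat) (l : \bar R) : (limn_einf u < l)%E ->
  forall n, exists2 k, (n <= k)%N & (u k < l)%E.
Proof.
move=> ul n; have : (einfs u n < l)%E.
  apply: le_lt_trans ul; rewrite limn_einf_lim.
  by rewrite (cvg_lim _ (@cvg_einfs_sup _ u))//; apply: ereal_sup_ubound; exists n.
by move=> /ereal_inf_lt[_ [k /= nk <-] ?]; exists k.
Qed.

Section Compact.
Variables (f : R -> R) (a b : R).
Hypothesis ab : a < b.
Hypothesis f_noninc : forall x y, a <= x -> x <= y -> y <= b -> f y <= f x.

(** On the cell [t_(i+1), t_(i+2)) the step function is the slope of the chord
    over two consecutive cells; the left end t_i of this chord is at a distance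
    between h and 2 h from any point of the cell. *)
Let h (m : nat) : R := (b - a) / m.+1%:R.
Let t m (i : nat) : R := a + i%:R * h m.
Let cell m i : set R := `[t m i.+1, t m i.+2[%classic.
Let slope m i : R := (f (t m i) - f (t m i.+2)) / h m.
Let step m (x : R) : \bar R := (\sum_(i < m) (slope m i)%:E * (\1_(cell m i) x)%:E)%E.

Let h_gt0 m : 0 < h m. Proof. by rewrite divr_gt0 ?subr_gt0. Qed.

Let t_le m i k : (i <= k)%N -> t m i <= t m k.
Proof. by move=> ik; rewrite lerD2l ler_wpM2r ?(ltW (h_gt0 _))// ler_nat. Qed.

Let t_ge m i : a <= t m i.
Proof. by rewrite lerDl mulr_ge0// ltW. Qed.

Let tS m i : t m i.+1 = t m i + h m.
Proof. by rewrite /t -natr1 mulrDl mul1r addrA. Qed.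

Let t_last m : t m m.+1 = b.
Proof. by rewrite /t /h mulrC divfK// addrC subrK. Qed.

Let t_leb m i : (i <= m.+1)%N -> t m i <= b.
Proof. by move=> im; rewrite -(t_last m) t_le. Qed.

Let slope_ge0 m i : (i < m)%N -> 0 <= slope m i.
Proof.
move=> im; rewrite divr_ge0 ?(ltW (h_gt0 _))// subr_ge0 f_noninc ?t_ge ?t_leb//.
by rewrite t_le// (leq_trans (leqnSn _)).
Qed.

Let term_ge0 m (i : 'I_m) x : (0 <= (slope m i)%:E * (\1_(cell m i) x)%:E)%E.
Proof. by rewrite mule_ge0 ?lee_fin ?slope_ge0. Qed.

Let mcell m i : measurable (cell m i : set R).
Proof. exact: measurable_itv. Qed.

Let mterm m (i : 'I_m) :
  measurable_fun [set: R] (fun x : R => ((slope m i)%:E * (\1_(cell m i) x)%:E)%E).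
Proof.
by apply: measurable_funeM; apply/measurable_EFinP; apply: measurable_indic; exact: mcell.
Qed.

Let mstep m : measurable_fun [set: R] (step m).
Proof. by apply: emeasurable_sum => i _; exact: mterm. Qed.

Let step_ge0 m x : (0 <= step m x)%E.
Proof. by apply: sume_ge0. Qed.

Let integral_step m : (\int[mu]_x step m x <= (2 * (f a - f b))%:E)%E.
Proof.
rewrite ge0_integral_sum//; last by move=> k; exact: mterm.
have E (i : 'I_m) : (\int[mu]_x ((slope m i)%:E * (\1_(cell m i) x)%:E) =
   (f (t m i) - f (t m i.+2))%:E)%E.
  rewrite ge0_integralZl_EFin ?slope_ge0//; last first.
    by apply/measurable_EFinP; apply: measurable_indic; exact: mcell.
  rewrite integral_indic; [|exact: measurableT|exact: mcell].
  rewrite /= setIT /cell lebesgue_measure_itv/= lte_fin (tS m i.+1) ltrDl h_gt0.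
  by rewrite -EFinB addrAC subrr add0r -EFinM -tS /slope divfK// lt0r_neq0.
under eq_bigr do rewrite E.
rewrite sumEFin lee_fin.
have -> : \sum_(i < m) (f (t m i) - f (t m i.+2)) =
   \sum_(i < m) (f (t m i) - f (t m i.+1)) + \sum_(i < m) (f (t m i.+1) - f (t m i.+2)).
  by rewrite -big_split/=; apply: eq_bigr => i _; rewrite addrA subrK.
rewrite -(big_mkord xpredT (fun i => f (t m i) - f (t m i.+1))).
rewrite -(big_mkord xpredT (fun i => f (t m i.+1) - f (t m i.+2))).
have tel (g : nat -> R) : \sum_(0 <= i < m) (g i - g i.+1) = g 0%N - g m.
  rewrite -[RHS]opprB -(telescope_sumr _ (leq0n m)) -sumrN.
  by apply: eq_bigr => i _; rewrite opprB.
rewrite (tel (fun i => f (t m i))) (tel (fun i => f (t m i.+1))).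
have f0 : f (t m 0) = f a by rewrite /t mul0r addr0.
have f1 : f (t m 1) <= f a by apply: f_noninc; rewrite ?t_ge ?t_leb.
have fm : f b <= f (t m m) by apply: f_noninc; rewrite ?t_ge ?t_leb.
rewrite f0 t_last; lra.
Qed.

(** The integrals of the step functions are all at most 2 (f a - f b), by
    telescoping; by Fatou's lemma their lower limit is finite almost everywhere.
    Where it is finite, slopes of arbitrarily short chords are bounded. *)
Lemma left_slopes_ae_compact : {ae mu, forall x, a < x < b ->
  exists M, forall e, 0 < e -> exists y, [/\ a <= y, x - e < y, y < x & f y - f x <= M * (x - y)]}.
Proof.
have fat := @fatou _ _ R mu setT measurableT step mstep (fun m x _ => step_ge0 m x).
have lim_ge0 x : (0 <= limn_einf (step ^~ x))%E.
  rewrite limn_einf_lim (cvg_lim _ (@cvg_einfs_sup _ _))//.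
  apply: (@le_trans _ _ (einfs (step ^~ x) 0%N)).
    by apply: le_ereal_inf_tmp => _ [k _ <-].
  by apply: ereal_sup_ubound; exists 0%N.
have int : mu.-integrable setT (fun x => limn_einf (step ^~ x)).
  apply/integrableP; split.
    rewrite /limn_einf; apply: measurableT_comp => //.
    by apply: measurable_fun_limn_esup => m; apply: measurableT_comp => //; exact: mstep.
  under eq_integral do rewrite gee0_abs//.
  apply: (le_lt_trans fat); rewrite (@le_lt_trans _ _ (2 * (f a - f b))%:E) ?ltry//.
  rewrite limn_einf_lim (cvg_lim _ (@cvg_einfs_sup _ _))//.
  apply: ge_ereal_sup => _ [n _ <-].
  apply: (@le_trans _ _ (\int[mu]_x step n x)%E); last exact: integral_step.
  by apply: ereal_inf_lbound; exists n => /=.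
have := integrable_ae measurableT int.
apply: filterS => x /(_ I) xfin /andP[ax xb].
pose M := fine (limn_einf (step ^~ x)) + 1.
have M0 : 0 <= M by rewrite addr_ge0// fine_ge0.
exists M => e e0.
have lM : (limn_einf (step ^~ x) < M%:E)%E.
  by rewrite -(fineK xfin) lte_fin ltrDl.
pose d := Num.min (e / 2) (x - a).
have d0 : 0 < d by rewrite lt_min divr_gt0// subr_gt0.
pose n := Num.truncn ((b - a) / d).
have [m nm um] := limn_einf_lt_frequently lM n.
have hd : h m < d.
  rewrite /h ltr_pdivrMr// mulrC -ltr_pdivrMr//.
  apply: (lt_le_trans (truncnS_gt _)); by rewrite ler_nat.
have [he hx] : h m < e / 2 /\ h m < x - a by move: hd; rewrite lt_min => /andP[].
pose k := Num.truncn ((x - a) / h m).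
have xa0 : 0 <= (x - a) / h m by rewrite divr_ge0 ?subr_ge0 ?ltW.
have /andP[k1 k2] := truncn_itv xa0.
have k0 : (0 < k)%N by rewrite truncn_gt0 ler_pdivlMr// mul1r ltW.
have km : (k < m.+1)%N.
  rewrite -(ltr_nat R) (le_lt_trans k1)// ltr_pdivrMr// /h mulrC divfK//.
  by rewrite ltrD2r.
move: k0 km k1 k2; rewrite -/k; case: k => // i _ im.
rewrite ler_pdivlMr// ltr_pdivrMr// => k1 k2.
have im' : (i < m)%N by [].
have xc : x \in cell m i.
  rewrite inE /cell/= in_itv/= /t -lerBrDl k1/= -ltrBlDl//.
have si : slope m i <= M.
  rewrite -lee_fin; apply: le_trans (ltW um).
  rewrite /step (bigD1 (Ordinal im'))//= indicE xc mule1 leeDl//.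
  by apply: sume_ge0.
have [xt1 xt2] : t m i.+1 <= x /\ x < t m i.+2.
  by move: xc; rewrite inE /cell/= in_itv/= => /andP[].
rewrite tS in xt1; rewrite !tS in xt2.
exists (t m i); split.
- exact: t_ge.
- by move: xt2 he; lra.
- by rewrite (lt_le_trans _ xt1)// ltrDl.
- have fx : f (t m i.+2) <= f x.
    by apply: f_noninc; rewrite ?(ltW ax) ?t_leb// !tS ltW.
  have : f (t m i) - f x <= slope m i * h m.
    by rewrite /slope divfK ?gt_eqF// lerD2l lerN2.
  move=> /le_trans; apply; rewrite ler_pM ?slope_ge0 ?(ltW (h_gt0 m))//.
  by rewrite lerBrDl.
Qed.

End Compact.

End LeftSlopes.

Section LeftSlopesInterval.
Context {R : realType}.
Local Notation mu := (@lebesgue_measure R).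

Let ae_filter : Filter (almost_everywhere mu).
Proof. exact: ae_filter_ringOfSetsType. Qed.

Lemma ae_neq (m : R) : {ae mu, forall x, x != m}.
Proof.
exists [set m]; split; [exact: measurable_set1|exact: lebesgue_measure_set1|].
by move=> x /= /negP; rewrite negbK => /eqP.
Qed.

Lemma almost_has_smaller (J : interval R) :
  exists m, forall x, x \in J -> x != m -> exists2 y, y \in J & y < x.
Proof.
have [[m [mJ mP]]|H] := pselect (exists m, m \in J /\ forall y, y \in J -> ~~ (y < m)).
  exists m => x xJ xm; exists m => //.
  by rewrite lt_neqAle eq_sym xm leNgt mP.
exists 0 => x xJ _; apply: contrapT => Hx; apply: H; exists x; split => // y yJ.
by apply/negP => yx; apply: Hx; exists y.
Qed.

Lemma almost_has_larger (J : interval R) :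
  exists m, forall x, x \in J -> x != m -> exists2 y, y \in J & x < y.
Proof.
have [[m [mJ mP]]|H] := pselect (exists m, m \in J /\ forall y, y \in J -> ~~ (m < y)).
  exists m => x xJ xm; exists m => //.
  by rewrite lt_neqAle xm leNgt mP.
exists 0 => x xJ _; apply: contrapT => Hx; apply: H; exists x; split => // y yJ.
by apply/negP => yx; apply: Hx; exists y.
Qed.

Lemma left_slopes_ae (J : interval R) (f : R -> R) :
  (forall x y, x \in J -> y \in J -> x <= y -> f y <= f x) ->
  {ae mu, forall x, x \in J -> exists M, forall e, 0 < e ->
    exists y, [/\ y \in J, x - e < y, y < x & f y - f x <= M * (x - y)]}.
Proof.
move=> fJ; have [m mP] := almost_has_smaller J; have [k kP] := almost_has_larger J.
pose Q (pq : rat * rat) x := [/\ ratr pq.1 \in J, ratr pq.2 \in J & ratr pq.1 < x < ratr pq.2] ->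
  exists M, forall e, 0 < e ->
    exists y, [/\ y \in J, x - e < y, y < x & f y - f x <= M * (x - y)].
have aeQ : {ae mu, forall x, forall n, if unpickle n is Some pq then Q pq x else True}.
  apply: ae_foralln => n; case: (unpickle n) => [[p q]|]; last exact: aeW.
  have [[pJ qJ pq]|H] := pselect [/\ ratr p \in J, ratr q \in J & ratr p < ratr q :> R]; last first.
    by apply: aeW => x [/= h1 h2 /andP[h3 h4]]; case: H; split => //; exact: lt_trans h4.
  have sub (x : R) : ratr p <= x -> x <= ratr q -> x \in J.
    by move=> px xq; apply: (interval_is_interval pJ qJ); rewrite px xq.
  have fn (x y : R) : ratr p <= x -> x <= y -> y <= ratr q -> f y <= f x.
    move=> px xy yq; apply: fJ => //; apply: sub => //; first exact: le_trans yq.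
    exact: le_trans xy.
  have := left_slopes_ae_compact pq fn; apply: (@filterS _ _ ae_filter) => x H [_ _ /= xpq].
  have [M MP] := H xpq; exists M => e e0; have [y [py xy yx fy]] := MP e e0.
  by exists y; split => //; apply: sub => //; case/andP: xpq => _ /ltW; apply: le_trans; exact: ltW.
have am := ae_neq m; have ak := ae_neq k.
apply: (@filterS3 _ _ ae_filter _ _ _ _ _ am ak aeQ) => x xm xk xQ xJ.
have [y yJ yx] := mP x xJ xm; have [z zJ xz] := kP x xJ xk.
have [p] := rat_in_itvoo yx; rewrite in_itv/= => /andP[yp px].
have [q] := rat_in_itvoo xz; rewrite in_itv/= => /andP[xq qz].
have := xQ (pickle (p, q)); rewrite pickleK; apply; split; rewrite ?px//.
- by apply: (interval_is_interval yJ xJ); rewrite !ltW.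
- by apply: (interval_is_interval xJ zJ); rewrite !ltW.
Qed.

End LeftSlopesInterval.

(** * The minimax level and the almost critical points *)

Section Minimax.
Context {R : realType} {E H : normedModType R}.
Context (ipH : {dot H for idfun}) (j : {linear E -> H}) (mu : R).
Variables (n : nat) (g0 g1 : 'rV[R]_n.+1 -> E).
Local Notation K := (@cylinder R n.+1).
Local Notation Gam := (Gamma ipH j mu g0 g1).
Local Notation minimax := (minimax ipH j mu g0 g1).
Implicit Types phi : E -> R^o.

Lemma sphere_neq0 : @sphere R n.+1 !=set0.
Proof.
exists (delta_mx 0 0); rewrite /sphere/= (bigD1 0)//= mxE !eqxx expr1n big1 ?addr0//.
by move=> i i0; rewrite mxE (negbTE i0) andbF expr0n.
Qed.

Lemma cylinder0 x : sphere n.+1 x -> K (0, x).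
Proof. by move=> xS; split => //=; rewrite in_itv/= lexx ler01. Qed.

Lemma cylinder1 x : sphere n.+1 x -> K (1, x).
Proof. by move=> xS; split => //=; rewrite in_itv/= lexx ler01. Qed.

Lemma Gamma_has_sup phi g : continuous phi -> Gam g -> has_sup [set phi (g p) | p in K].
Proof.
move=> phic [gc _ _ _ _]; split.
  by have [x /cylinder0 Kx] := sphere_neq0; exists (phi (g (0, x))), (0, x).
have pc : {within K, continuous (phi \o g)}.
  by move=> x; apply: (continuous_comp (gc x)); exact: phic.
have /compact_bounded/pinfty_ex_gt0[M _ MB] := continuous_compact pc (cylinder_compact (n := n.+1)).
exists M => _ [p Kp <-]; apply: (le_trans (ler_norm _)).
by apply: (MB (phi (g p))); exists p.
Qed.

Lemma le_sup_curve phi g p : continuous phi -> Gam g -> K p ->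
  phi (g p) <= sup [set phi (g p) | p in K].
Proof.
by move=> phic gG Kp; apply: ub_le_sup; [exact: (Gamma_has_sup phic gG).2|exists p].
Qed.

Lemma minimax_has_inf phi : continuous phi -> Gam !=set0 ->
  has_inf [set sup [set phi (g p) | p in K] | g in Gam].
Proof.
move=> phic [g gG]; split; first by exists (sup [set phi (g p) | p in K]), g.
have [x xS] := sphere_neq0; exists (phi (g0 x)) => _ [h hG <-].
have [_ _ _ h0 _] := hG; rewrite -h0//.
by apply: le_sup_curve => //; exact: cylinder0.
Qed.

Lemma minimax_le phi g : continuous phi -> Gam g ->
  minimax phi <= sup [set phi (g p) | p in K].
Proof.
move=> phic gG; apply: ge_inf; last by exists g.
by have [] := minimax_has_inf phic (ex_intro _ g gG).
Qed.

Lemma minimax_mono phi psi : continuous phi -> continuous psi -> Gam !=set0 ->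
  (forall u, phi u <= psi u) -> minimax phi <= minimax psi.
Proof.
move=> phic psic G0 le; apply: lb_le_inf; first by have [] := minimax_has_inf psic G0.
move=> _ [g gG <-]; apply: (le_trans (minimax_le phic gG)).
apply: sup_le_ub; first by have [] := Gamma_has_sup phic gG.
by move=> _ [p Kp <-]; rewrite (le_trans (le _))//; exact: le_sup_curve.
Qed.

Lemma le_endmax phi x : continuous phi -> Gam !=set0 -> sphere n.+1 x ->
  phi (g0 x) <= endmax g0 g1 phi /\ phi (g1 x) <= endmax g0 g1 phi.
Proof.
move=> phic [g gG] xS; have [_ _ _ h0 h1] := gG.
have ub : has_ubound [set y | exists2 x, sphere n.+1 x & y = phi (g0 x) \/ y = phi (g1 x)].
  exists (sup [set phi (g p) | p in K]) => y [z zS [->|->]].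
    by rewrite -h0//; apply: le_sup_curve => //; exact: cylinder0.
  by rewrite -h1//; apply: le_sup_curve => //; exact: cylinder1.
by split; apply: ub_le_sup => //; exists x => //; [left|right].
Qed.

End Minimax.

Section DescentPoints.
Context {R : realType} {E H : normedModType R}.
Context (ipH : {dot H for idfun}) (j : {linear E -> H}).
Local Notation "''[' u , v ]" := (ipH (j u) (j v)) : ring_scope.

Lemma dnorm_restr_gt (phi : E -> R^o) (u : E) (del : R) : dnorm_restr ipH j phi u > del ->
  exists w, [/\ '[u, w] = 0, `|w| <= 1 & D1 phi u w <= - del].
Proof.
move=> dn; apply: contrapT => Hw; move: dn; apply/negP; rewrite -leNgt.
apply: sup_le_ub.
  by exists `|D1 phi u 0|, 0 => //; split; rewrite ?normr0// /tangent/= linear0 linear0r.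
move=> _ [v [tv v1] <-]; rewrite leNgt; apply/negP => dv; apply: Hw.
have [D0|D0] := lerP (D1 phi u v) 0.
  by exists v; split => //; move: dv; rewrite ler0_norm// ltrNr => /ltW.
exists (- v); rewrite normrN; split => //; first by rewrite dotNr tv oppr0.
by rewrite linearN/= lerN2; move: dv; rewrite gtr0_norm// => /ltW.
Qed.

Lemma submod_sum (L : {pred E}) k (v : 'I_k -> E) (a : 'I_k -> R) :
  submod_closed L -> (forall i, v i \in L) -> \sum_i a i *: v i \in L.
Proof.
move=> [L0 LD] vL; elim/big_rec : _ => // i x _ xL.
exact: LD.
Qed.

Lemma approx_morse_gt n (phi : E -> R^o) (u : E) (del : R) :
  ~~ (approx_morse ipH j phi del u <= n.+1%:R%:E)%E ->
  exists k (v : 'I_k -> E), [/\ (n.+1 < k)%N, lin_indep v &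
     forall a : 'I_k -> R, let w := \sum_i a i *: v i in '[u, w] = 0 /\
       (w != 0 -> Dsq ipH j phi u w w < - del * `|w| ^+ 2)].
Proof.
rewrite -ltNge => /ereal_sup_gt[_ [L [Lsub Ltan Lneg] <-]].
move=> /ereal_sup_gt[_ [k [v vL vI] <-]]; rewrite lte_fin ltr_nat => nk.
exists k, v; split => // a w; have wL : w \in L by exact: submod_sum.
by split; [exact: Ltan|move=> w0; exact: Lneg].
Qed.

End DescentPoints.

Section AlmostCritical.
Context {R : realType} {E H : normedModType R}.
Context (ipH : {dot H for idfun}) (j : {linear E -> H}) (mu : R).
Hypotheses (ipH_norm : induces_norm ipH) (j_norm : forall u, `|j u| <= `|u|).
Hypothesis mu_gt0 : 0 < mu.
Variables (n : nat) (g0 g1 : 'rV[R]_n.+1 -> E).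
Local Notation S := (Smu ipH j mu).
Local Notation K := (@cylinder R n.+1).
Local Notation Gam := (Gamma ipH j mu g0 g1).
Local Notation minimax := (minimax ipH j mu g0 g1).

Lemma Gamma_odd_curve g : Gam g -> odd_curve ipH j mu g.
Proof.
move=> [gc gS godd _ _]; split => // -[t x] [/= t01 xS].
by apply: (godd t t01).
Qed.

(** Applied to a curve g with max (phi o g) <= c + L e whose part above c - e is
    bounded, [deformation] with margin e / 2 gives a competitor with maximum at
    most c - e / 2, as soon as (L + 1) e <= eta.  Below the level c - 3 e / 2,
    thus at both ends of the cylinder, it coincides with g. *)
Lemma almost_critical (phi : E -> R^o) (alpha K0 L : R) :
  C2 phi -> 0 < alpha -> holder_on_bounded alpha (D1 phi) -> holder_on_bounded alpha (D2 phi) ->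
  (forall u, S u -> phi (- u) = phi u) -> endmax g0 g1 phi < minimax phi -> 0 <= L ->
  (forall e0, 0 < e0 -> exists e g, [/\ 0 < e <= e0, Gam g &
     forall p, K p -> phi (g p) <= minimax phi + L * e /\
       (minimax phi - e <= phi (g p) -> `|g p| <= K0)]) ->
  forall del, 0 < del -> exists u, [/\ S u, `|phi u - minimax phi| <= del,
    dnorm_restr ipH j phi u <= del, `|u| <= K0 &
    (approx_morse ipH j phi del u <= n.+2%:R%:E)%E].
Proof.
move=> phiC a0 h1 h2 phiE; set c := minimax phi => cend L0 curves del del0.
have phic : continuous phi.
  by move=> u; apply: differentiable_continuous; case: phiC.
apply: contrapT => Hu.
have bad u : S u -> `|phi u - c| <= del -> `|u| <= K0 -> descent_point ipH j phi n.+1 del u.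
  move=> uS uc uK; have [dn|dn] := lerP (dnorm_restr ipH j phi u) del; last first.
    by left; exact: dnorm_restr_gt.
  right; apply: approx_morse_gt; apply/negP => am; apply: Hu.
  by exists u; split.
have [C [C1 radC muC bdD ucD]] := holder_D12 mu (K0 + 1) a0 h1 h2.
have [eta eta0 deform] := deformation ipH_norm j_norm mu_gt0 phiC C1
  radC muC bdD ucD n.+1 phiE del0.
have L1 : 0 < L + 1 by rewrite ltr_wpDl.
pose e0 := Num.min (del / (L + 1)) (Num.min (eta / (L + 1)) ((c - endmax g0 g1 phi) / 2)).
have e00 : 0 < e0 by rewrite !lt_min !divr_gt0// subr_gt0.
have [e [g [/andP[ep ee0] gG gP]]] := curves e0 e00.
move: ee0; rewrite /e0 !le_min !ler_pdivlMr// => /and3P[e1 e2 e3].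
have Le : L * e <= del by rewrite (le_trans _ e1)// mulrC ler_pM2l// lerDl.
have ed : e <= del by rewrite (le_trans _ e1)// ler_peMr ?(ltW ep)// lerDr.
have e20 : 0 < e / 2 by rewrite divr_gt0.
have [|h [hc hP]] := deform g (c - e) (e / 2) (Gamma_odd_curve gG) e20.
  move=> p Kp cp; have [g_up g_bd] := gP p Kp; rewrite addrK; split; first exact: g_bd.
  have [_ gS _ _ _] := gG; apply: bad; [exact: gS| |exact: g_bd].
  by rewrite ler_norml; apply/andP; split; move: cp g_up ed Le; lra.
have hG : Gam h.
  have [gc gS godd gg0 gg1] := gG; have [hcont hS hodd] := hc.
  have [low0 low1] : (forall x, sphere n.+1 x -> phi (g (0, x)) <= c - e - e / 2) /\
      (forall x, sphere n.+1 x -> phi (g (1, x)) <= c - e - e / 2).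
    split=> x xS; have [ex0 ex1] := le_endmax phic (ex_intro _ g gG) xS.
      by rewrite gg0//; move: ex0 e3 ep; lra.
    by rewrite gg1//; move: ex1 e3 ep; lra.
  split => //.
  - by move=> t t01 x xS; exact: (hodd (t, x)).
  - move=> x xS; have [_ _ ->] := hP _ (cylinder0 xS); [exact: gg0|exact: low0].
  - move=> x xS; have [_ _ ->] := hP _ (cylinder1 xS); [exact: gg1|exact: low1].
have : c <= c - e / 2.
  rewrite {1}/c (le_trans (minimax_le phic hG))//; apply: sup_le_ub.
    by have [] := Gamma_has_sup phic hG.
  move=> _ [p Kp <-]; have [hp1 hp2 _] := hP p Kp; have [g_up _] := gP p Kp.
  have [cp|cp] := lerP (c - e) (phi (g p)).
    by have := hp2 cp; move: g_up e2; lra.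
  by move: hp1 cp; lra.
by rewrite lerBrDr gerDl leNgt e20.
Qed.

End AlmostCritical.

(** With e = rho - s, the slope bound gives c s + e <= c rho + L e for
    L = |M| + 1.  Where Phi rho >= c rho - e, the identity
    e * B = Phi s - Phi rho bounds B by L + 1, and then A = Phi rho + rho * B. *)
Lemma bounded_curves (R : realType) (E H : normedModType R)
    (ipH : {dot H for idfun}) (j : {linear E -> H}) (mu : R) (n : nat)
    (g0 g1 : 'rV[R]_n.+1 -> E) (I : interval R) (A B : E -> R) (Phi : R -> E -> R^o)
    (rho M : R) (c := fun s => minimax ipH j mu g0 g1 (Phi s)) :
  (forall s, s \in I -> 0 < s) ->
  (forall s, s \in I -> forall u, Phi s u = A u - s * B u) ->
  (forall s, s \in I -> continuous (Phi s)) ->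
  (forall u, 0 <= B u) -> coercive A \/ coercive B ->
  Gamma ipH j mu g0 g1 !=set0 -> rho \in I ->
  (forall e, 0 < e -> exists s,
    [/\ s \in I, rho - e < s, s < rho & c s - c rho <= M * (rho - s)]) ->
  exists K0 L, 0 <= L /\ forall e0, 0 < e0 -> exists e g, [/\ 0 < e <= e0,
     Gamma ipH j mu g0 g1 g &
     forall p, cylinder n.+1 p -> Phi rho (g p) <= c rho + L * e /\
       (c rho - e <= Phi rho (g p) -> `|g p| <= K0)].
Proof.
move=> I0 PhiE Phic B0 AB G0 rI slope.
have rho0 := I0 rho rI.
pose L := `|M| + 1; have L0 : 0 <= L by rewrite addr_ge0.
pose K1 := c rho + L + rho * (L + 1).
have [K0 K0P] : exists K0, forall u, B u <= L + 1 -> A u <= K1 -> `|u| <= K0.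
  case: AB => [/(_ (K1 + 1))|/(_ (L + 1 + 1))] [r rP]; exists r => u Bu Au;
    rewrite leNgt; apply/negP => /ltW/rP.
    by rewrite leNgt (le_lt_trans Au)// ltrDl.
  by rewrite leNgt (le_lt_trans Bu)// ltrDl.
exists K0, L; split => // e0 e00.
have e10 : 0 < Num.min e0 1 by rewrite lt_min e00 ltr01.
have [s [sI rs sr cs]] := slope _ e10.
pose e := rho - s; have ep : 0 < e by rewrite subr_gt0.
have : e <= Num.min e0 1 by rewrite ltW// ltrBlDl -ltrBlDr.
rewrite le_min => /andP[ee0 ee1].
have [_ [g gG <-] gs] := inf_adherent ep (minimax_has_inf (Phic s sI) G0).
exists e, g; split => //; first by rewrite ep.
move=> p Kp; have up : Phi s (g p) <= c rho + L * e.
  have h1 := le_sup_curve (Phic s sI) gG Kp.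
  have h2 : M * e <= `|M| * e by rewrite ler_wpM2r ?(ltW ep)// ler_norm.
  rewrite (le_trans h1)// (le_trans (ltW gs))//.
  rewrite (_ : c rho + L * e = c rho + `|M| * e + e); last by rewrite mulrDl mul1r addrA.
  by rewrite lerD2r -lerBlDl (le_trans cs).
have Phi_s := PhiE s sI (g p); have Phi_r := PhiE rho rI (g p).
have eB : e * B (g p) = Phi s (g p) - Phi rho (g p).
  by rewrite Phi_s Phi_r /e; lra.
have eB0 : 0 <= e * B (g p) by rewrite mulr_ge0// ltW.
have le_rs : Phi rho (g p) <= Phi s (g p) by rewrite -subr_ge0 -eB.
split; first exact: le_trans up.
move=> low; have Bu : B (g p) <= L + 1.
  by rewrite -(ler_pM2l ep) eB; lra.
apply: K0P => //.
have rB : rho * B (g p) <= rho * (L + 1) by rewrite ler_pM2l.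
have Le : L * e <= L by rewrite ler_piMr.
rewrite /K1; move: Phi_r le_rs up rB Le => ->; lra.
Qed.

Lemma dnorm_restr_ge0 (R : realType) (E H : normedModType R)
    (ipH : {dot H for idfun}) (j : {linear E -> H}) (phi : E -> R^o) (u : E) :
  0 <= dnorm_restr ipH j phi u.
Proof.
rewrite /dnorm_restr /opnorm_on; set D := (X in sup X).
have [hs|hs] := pselect (has_sup D); last by rewrite sup_out.
apply: (@le_trans _ _ `|D1 phi u 0|) => //; apply: (ub_le_sup hs.2).
by exists 0 => //; split; rewrite ?normr0// /tangent/= linear0 linear0r.
Qed.

Theorem theorem1p12 (R : realType) (E H : completeNormedModType R)
  (ipE : {dot E for idfun}) (ipH : {dot H for idfun}) (j : {linear E -> H})
  (ipE_norm : induces_norm ipE) (ipH_norm : induces_norm ipH)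
  (dimE : edim [pred _ : E | true] = +oo%E)
  (dimH : edim [pred _ : H | true] = +oo%E)
  (j_inj : injective j) (j_norm : forall u, `|j u| <= `|u|)
  (HE'_inj : injective (fun (h : H) (u : E) => ipH h (j u)))
  (mu : R) (mu_gt0 : 0 < mu)
  (I : interval R) (I_pos : forall rho, rho \in I -> 0 < rho)
  (A B : E -> R) (Phi : R -> E -> R^o)
  (PhiE : forall rho, rho \in I -> forall u, Phi rho u = A u - rho * B u)
  (Phi_C2 : forall rho, rho \in I -> C2 (Phi rho))
  (B_ge0 : forall u, 0 <= B u)
  (AB_coercive : coercive A \/ coercive B)
  (Phi_even : forall rho, rho \in I ->
     forall u, Smu ipH j mu u -> Phi rho (- u) = Phi rho u)
  (alpha : R) (alpha_gt0 : 0 < alpha) (alpha_le1 : alpha <= 1)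
  (Phi_holder : forall rho, rho \in I ->
     holder_on_bounded alpha (D1 (Phi rho)) /\
     holder_on_bounded alpha (D2 (Phi rho)))
  (N : nat) (N_ge2 : (2 <= N)%N)
  (gamma0 gamma1 : 'rV[R]_N.-1 -> E)
  (gamma0_S : forall x, sphere _ x -> Smu ipH j mu (gamma0 x))
  (gamma1_S : forall x, sphere _ x -> Smu ipH j mu (gamma1 x))
  (gamma0_odd : odd_on gamma0) (gamma1_odd : odd_on gamma1)
  (Gamma_neq0 : Gamma ipH j mu gamma0 gamma1 !=set0)
  (mountain_pass : forall rho, rho \in I ->
     endmax gamma0 gamma1 (Phi rho) <
     minimax ipH j mu gamma0 gamma1 (Phi rho)) :
  {ae @lebesgue_measure R, forall rho : R, rho \in I ->
    exists (u : nat -> E) (zeta : nat -> R),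
      [/\ (forall n, Smu ipH j mu (u n)),
          (forall n, 0 < zeta n) /\ zeta n @[n --> \oo] --> 0 &
      [/\ Phi rho (u n) @[n --> \oo] -->
            minimax ipH j mu gamma0 gamma1 (Phi rho),
          dnorm_restr ipH j (Phi rho) (u n) @[n --> \oo] --> 0,
          (exists M : R, forall n, `|u n| <= M) &
          forall n, (approx_morse ipH j (Phi rho) (zeta n) (u n)
                     <= N%:R%:E)%E]]}.
Proof.
case: N N_ge2 gamma0 gamma1 gamma0_S gamma1_S gamma0_odd gamma1_odd Gamma_neq0 mountain_pass
  => [|[|n]]// _ gamma0 gamma1 _ _ _ _ G0 mp.
have Phic s : s \in I -> continuous (Phi s).
  by move=> sI u; apply: differentiable_continuous; case: (Phi_C2 s sI).
pose c s := minimax ipH j mu gamma0 gamma1 (Phi s).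
have c_noninc x y : x \in I -> y \in I -> x <= y -> c y <= c x.
  move=> xI yI xy; apply: minimax_mono => //; [exact: Phic|exact: Phic|].
  by move=> u; rewrite !PhiE// lerD2l lerN2 ler_wpM2r.
have := left_slopes_ae c_noninc.
apply: (@filterS _ _ (ae_filter_ringOfSetsType _)) => rho slope rI.
have [M MP] := slope rI.
have [K0 [L [L0 curves]]] := bounded_curves I_pos PhiE Phic B_ge0 AB_coercive G0 rI MP.
have [h1 h2] := Phi_holder rho rI.
have crit := almost_critical ipH_norm j_norm mu_gt0 (Phi_C2 rho rI) alpha_gt0 h1 h2
  (Phi_even rho rI) (mp rho rI) L0 curves.
pose zeta n : R := n.+1%:R^-1.
have z0 m : 0 < zeta m by rewrite invr_gt0.
have /choice[u uP] : forall m, exists u, [/\ Smu ipH j mu u, `|Phi rho u - c rho| <= zeta m,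
    dnorm_restr ipH j (Phi rho) u <= zeta m, `|u| <= K0 &
    (approx_morse ipH j (Phi rho) (zeta m) u <= n.+2%:R%:E)%E].
  by move=> m; exact: crit.
have zc : zeta m @[m --> \oo] --> 0 by exact: cvg_harmonic.
exists u, zeta; split; [by move=> m; have [] := uP m|by []|split].
- apply/cvgrPdist_le => e e0.
  near=> m; apply: (@le_trans _ _ (zeta m)).
    by have [_ + _ _ _] := uP m; rewrite distrC.
  have : `|0 - zeta m| <= e by near: m; exact: (iffLR (cvgrPdist_le _ _) zc) e e0.
  by rewrite sub0r normrN gtr0_norm.
- apply: (@squeeze_cvgr _ _ _ _ (cst 0) zeta) => //; last exact: cvg_cst.
  apply: nearW => m; have [_ _ -> _ _] := uP m; rewrite andbT.
  exact: dnorm_restr_ge0.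
- by exists K0 => m; have [] := uP m.
- by move=> m; have [] := uP m.
Unshelve. all: by end_near. Qed.
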